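(* For any integers $d\ge2$ and $h\ge0$, the sequence $(\mathsf{N}_{d,h,k})_{k\in\mathbb{Z}}$ is symmetric and strictly unimodal. For any integers $d\ge2$ and $h\ge0$, the sequences $(\mathsf{N}^{(1)}_{d,h,k})_{k\in\mathbb{Z}}$ and $(\mathsf{N}^{(3)}_{d,h,k})_{k\in\mathbb{Z}}$ are symmetric and unimodal.
   Context: Let $y=-e^{2\pi iz}$, $q=e^{2\pi i\tau}$, $(a;q)_\infty=\prod_{j\ge0}(1-aq^j)$, $(a,b,c;q)_\infty=(a;q)_\infty(b;q)_\infty(c;q)_\infty$, $\eta(\tau)=q^{1/24}(q;q)_\infty$ and $\vartheta_1(z,\tau)=q^{1/8}(y^{-1/2}+y^{1/2})(q,-yq,-y^{-1}q;q)_\infty$. Let $G(z,\tau)=\eta(\tau)^{-6}\vartheta_1(z,\tau)^2\left(y\frac{d}{dy}\right)^2\log\vartheta_1(z,\tau)$. The numbers $\mathsf{N}_{d,h,k},\mathsf{N}^{(1)}_{d,h,k},\mathsf{N}^{(3)}_{d,h,k}$ (genus $0$ Gromov–Witten invariants of the Hilbert scheme of $d$ points of an elliptic K3 surface) are defined by the expansions $$\sum_{h\ge0}\sum_{k}\mathsf{N}_{d,h,k}y^kq^{h-1}=\eta^{-24}\Big(\frac{\vartheta_1}{\eta^3}\Big)^{2d-2},\quad \sum_{h\ge0}\sum_k\mathsf{N}^{(1)}_{d,h,k}y^kq^{h-1}=\eta^{-24}G^{d-1},$$ $$\sum_{h\ge0}\sum_k\mathsf{N}^{(3)}_{d,h,k}y^kq^{h-1}=\frac1d\binom{2d-2}{d-1}\eta^{-24}\,q\frac{d}{dq}G^{d-1}.$$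 A two-sided sequence with finitely many nonzero terms is symmetric if its $k$-th and $(-k)$-th terms agree, and unimodal (resp. strictly unimodal) if, restricted to the smallest interval of indices containing all nonzero terms, it first weakly (resp. strictly) increases and then weakly (resp. strictly) decreases. *)

(* Defs.v *)
From HB Require Import structures.
From mathcomp Require Import all_boot all_order all_algebra.
From mathcomp Require Import fraction generic_quotient.

Set Implicit Arguments.
Unset Strict Implicit.
Unset Printing Implicit Defensive.

Import Order.TTheory GRing.Theory Num.Theory.
Local Open Scope ring_scope.

(* A formal power series over a field [F] is its coefficient sequence. *)

Section PowerSeries.
Variable F : fieldType.
Implicit Types f g : nat -> F.

Definition ps_one : nat -> F := fun n => (n == 0%N)%:R.

Definition ps_mul f g : nat -> F :=
  fun n => \sum_(i < n.+1) f i * g (n - i)%N.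

Definition ps_exp f (m : nat) : nat -> F := iter m (ps_mul f) ps_one.

(* For [f 0 != 0], put c = f 0; then 1 - f / c has no constant term and
   1 / f = c^-1 * \sum_j (1 - f / c)^j, where only the terms j <= n
   contribute to the n-th coefficient. *)
Definition ps_inv f : nat -> F :=
  fun n => (f 0%N)^-1 *
    \sum_(j < n.+1) ps_exp (fun i => ps_one i - (f 0%N)^-1 * f i) j n.

(* (a; q)_oo for [a] polynomial in q = 'X: the factors 1 - a * q ^ j with
   j > n do not affect the coefficient of q ^ n. *)
Definition qpoch (a : {poly F}) : nat -> F :=
  fun n => (\prod_(j < n.+1) (1 - a * 'X^j))`_n.

End PowerSeries.

(* The field Q(s) of rational functions in s = y^(1/2). *)
Definition Qs : fieldType := {fraction {poly rat}}.

Definition ratfun (p : {poly rat}) : Qs := @FracField.tofrac {poly rat} p.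
Definition numer (f : Qs) : {poly rat} := (repr f).1.
Definition denom (f : Qs) : {poly rat} := (repr f).2.

Definition sqrty : Qs := ratfun 'X.
Definition y : Qs := sqrty ^+ 2.

Definition ds (f : Qs) : Qs :=
  ratfun ((numer f)^`() * denom f - numer f * (denom f)^`())
  / ratfun (denom f) ^+ 2.

(* y d/dy, which is (s / 2) d/ds since y = s ^ 2. *)
Definition ydy (f : Qs) : Qs := 2%:R^-1 * sqrty * ds f.

(* The coefficient of y ^ k = s ^ (2 k) in the Laurent expansion of [f] at
   s = 0. When [f] is a Laurent polynomial in y, as are all the coefficients
   of powers of q to which this is applied below, these are its coefficients. *)
Definition ycoef (f : Qs) (k : int) : rat :=
  let m := mup 0 (denom f) in
  let d0 := denom f %/ 'X^m in
  if 2%:Z * k + m%:Z is Posz n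
  then ps_mul (fun i => (numer f)`_i) (ps_inv (fun i => d0`_i)) n
  else 0.

(* [QSer e f] is the series q ^ e * \sum_n (f n) q ^ n, with [e] rational. *)
Record qser := QSer { qexp : rat; qcoefs : nat -> Qs }.

Definition qs_mul (A B : qser) : qser :=
  QSer (qexp A + qexp B) (ps_mul (qcoefs A) (qcoefs B)).

Definition qs_exp (A : qser) (m : nat) : qser :=
  QSer (qexp A *+ m) (ps_exp (qcoefs A) m).

Definition qs_inv (A : qser) : qser := QSer (- qexp A) (ps_inv (qcoefs A)).

Definition qs_scale (c : rat) (A : qser) : qser :=
  QSer (qexp A) (fun n => ratfun c%:P * qcoefs A n).

(* y d/dy and q d/dq *)
Definition qs_ydy (A : qser) : qser :=
  QSer (qexp A) (fun n => ydy (qcoefs A n)).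

Definition qs_qdq (A : qser) : qser :=
  QSer (qexp A) (fun n => ratfun (qexp A + n%:R)%:P * qcoefs A n).

(* (y d/dy) log A, the logarithmic derivative *)
Definition qs_ydy_log (A : qser) : qser := qs_mul (qs_ydy A) (qs_inv A).

(* The coefficient of q ^ r. *)
Definition qcoef (A : qser) (r : rat) : Qs :=
  if r - qexp A \is a Num.nat then qcoefs A (Num.truncn (r - qexp A)) else 0.

Definition eta : qser := QSer (1 / 24%:R) (qpoch 'X).

Definition theta1 : qser :=
  QSer (1 / 8%:R)
    (fun n => (sqrty^-1 + sqrty) *
       ps_mul (ps_mul (qpoch 'X) (qpoch (- (y *: 'X)))) (qpoch (- (y^-1 *: 'X))) n).

Definition G : qser :=
  qs_mul (qs_mul (qs_inv (qs_exp eta 6)) (qs_exp theta1 2))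
    (qs_ydy (qs_ydy_log theta1)).

Definition genN (d : nat) : qser :=
  qs_mul (qs_inv (qs_exp eta 24))
    (qs_exp (qs_mul theta1 (qs_inv (qs_exp eta 3))) (2 * d - 2)).

Definition genN1 (d : nat) : qser :=
  qs_mul (qs_inv (qs_exp eta 24)) (qs_exp G (d - 1)).

Definition genN3 (d : nat) : qser :=
  qs_scale (1 / d%:R * 'C(2 * d - 2, d - 1)%:R)
    (qs_mul (qs_inv (qs_exp eta 24)) (qs_qdq (qs_exp G (d - 1)))).

(* The coefficients of y ^ k * q ^ (h - 1). *)
Definition GWN (d h : nat) (k : int) : rat :=
  ycoef (qcoef (genN d) (h%:R - 1)) k.
Definition GWN1 (d h : nat) (k : int) : rat :=
  ycoef (qcoef (genN1 d) (h%:R - 1)) k.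
Definition GWN3 (d h : nat) (k : int) : rat :=
  ycoef (qcoef (genN3 d) (h%:R - 1)) k.

Definition finitely_supported (a : int -> rat) : Prop :=
  exists l u : int, forall k : int, a k != 0 -> l <= k <= u.

Definition symmetric_seq (a : int -> rat) : Prop :=
  forall k : int, a k = a (- k).

(* The smallest interval of indices containing all nonzero terms, as the
   intersection of all such intervals (empty if [a] vanishes). *)
Definition in_hull (a : int -> rat) (k : int) : Prop :=
  forall l u : int, (forall i : int, a i != 0 -> l <= i <= u) -> l <= k <= u.

Definition unimodal (a : int -> rat) : Prop :=
  exists m : int, forall i j : int, in_hull a i -> in_hull a j -> i < j ->
    (j <= m -> a i <= a j) /\ (m <= i -> a j <= a i).

Definition strictly_unimodal (a : int -> rat) : Prop :=
  exists m : int, forall i j : int, in_hull a i -> in_hull a j -> i < j ->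
    (j <= m -> a i < a j) /\ (m <= i -> a j < a i).

(* Main.v *)
(** A symmetric Laurent polynomial in s = y^(1/2) whose exponents have a fixed
    parity is unimodal iff it is a nonnegative combination of the SL_2
    characters s^r + s^(r-2) + ... + s^-r; it is strictly unimodal if moreover
    every character of the right parity up to the top one occurs. By the
    Clebsch-Gordan rule both properties are stable under products.

    By the Jacobi triple product, with T_n = n(n+1)/2,
    theta_1 = q^(1/8) sum_n q^(T_n) (s^(2n+1) + s^-(2n+1)), which in terms of
    characters is sum_n q^(T_n) (1 - q^(n+1)) chi_(2n+1); as
    (1 - q^(n+1)) / (q;q)^3 has positive coefficients, every coefficient of
    theta_1 / eta^3 is strictly unimodal.

    Writing ' for y d/dy, G = eta^-6 (theta_1 theta_1'' - theta_1'^2), and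
    regrouping the double sum by a = m + n + 1 and b = m - n gives
    G = (q;q)^-6 sum_a q^[a^2/4] M_a (y^a + y^-a) (the term a = 0 being counted
    once), where M_a is the sum of b^2 q^[b^2/4] over b > 0 of parity opposite
    to a. Unimodality of G thus reduces to (M_0 - M_1) / (q;q)^6 >= 0 and
    (M_1 - q M_0) / (q;q)^6 >= 0. Already (M_0 - M_1) / (1-q)^4 and
    (M_1 - q M_0) / (1-q)^3 have nonnegative coefficients: these are finite
    alternating sums, hence explicit polynomials in m and r on the ranges
    n = m^2 + r and n = m^2 + m + r. *)

Require Import Defs.
From HB Require Import structures.
From mathcomp Require Import all_boot all_order all_algebra.
From mathcomp Require Import boolp fraction generic_quotient.
From mathcomp Require Import ring lra zify.

Set Implicit Arguments.
Unset Strict Implicit.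
Unset Printing Implicit Defensive.

Import Order.TTheory GRing.Theory Num.Theory.
Local Open Scope ring_scope.

(** * Formal power series *)

(** A separate name to which a ring structure can be attached. It stays convertible to the raw
    [nat -> F], so that [ps_mul] is the ring product by definition. *)
Definition pser (F : fieldType) : Type := nat -> F.

Section PowerSeriesRing.
Variable F : fieldType.
Implicit Types f g h : pser F.

HB.instance Definition _ := gen_eqMixin (pser F).
HB.instance Definition _ := gen_choiceMixin (pser F).

Definition ps_add f g : pser F := fun n => f n + g n.
Definition ps_opp f : pser F := fun n => - f n.
Definition ps_zero : pser F := fun=> 0.

Lemma ps_addA : associative ps_add.
Proof. by move=> f g h; apply/funext => n; rewrite /ps_add addrA. Qed.
Lemma ps_addC : commutative ps_add.
Proof. by move=> f g; apply/funext => n; rewrite /ps_add addrC. Qed.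
Lemma ps_add0 : left_id ps_zero ps_add.
Proof. by move=> f; apply/funext => n; rewrite /ps_add add0r. Qed.
Lemma ps_addN : left_inverse ps_zero ps_opp ps_add.
Proof. by move=> f; apply/funext => n; rewrite /ps_add addNr. Qed.

HB.instance Definition _ :=
  GRing.isZmodule.Build (pser F) ps_addA ps_addC ps_add0 ps_addN.

(** The coefficients up to order n of a product depend only on these truncations, so commutativity
    and associativity are inherited from polynomials. *)
Definition truncp n f : {poly F} := \poly_(i < n.+1) f i.

Lemma coef_truncp n f i : (i <= n)%N -> (truncp n f)`_i = f i.
Proof. by move=> lein; rewrite coef_poly ltnS lein. Qed.

Lemma ps_mul_truncp n f g i : (i <= n)%N ->
  ps_mul f g i = (truncp n f * truncp n g)`_i.
Proof.
move=> lein; rewrite coefM; apply: eq_bigr => j _.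
have leji : (j <= i)%N by rewrite -ltnS.
by rewrite !coef_truncp // (leq_trans _ lein) // leq_subr.
Qed.

Lemma ps_mulC : commutative (@ps_mul F : pser F -> pser F -> pser F).
Proof.
by move=> f g; apply/funext => n; rewrite !(@ps_mul_truncp n) // mulrC.
Qed.

Lemma ps_mulA : associative (@ps_mul F : pser F -> pser F -> pser F).
Proof.
have mulE (f g h : pser F) n :
  ps_mul f (ps_mul g h) n = (truncp n f * (truncp n g * truncp n h))`_n.
  rewrite [RHS]coefM; apply: eq_bigr => j _.
  have lejn : (j <= n)%N by rewrite -ltnS.
  by rewrite coef_truncp // -ps_mul_truncp // leq_subr.
move=> f g h; apply/funext => n.
rewrite mulE (ps_mulC (ps_mul f g)) mulE.
by congr (_`_n); rewrite mulrA mulrC.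
Qed.

Lemma ps_mul1 : left_id (@ps_one F : pser F) (@ps_mul F).
Proof.
move=> f; apply/funext => n; rewrite /ps_mul big_ord_recl /= subn0.
rewrite big1 ?addr0 ?/ps_one ?mul1r // => i _.
by rewrite mul0r.
Qed.

Lemma ps_mulDl : left_distributive (@ps_mul F) ps_add.
Proof.
move=> f g h; apply/funext => n; rewrite /ps_mul /ps_add -big_split.
by apply: eq_bigr => i _; rewrite mulrDl.
Qed.

Lemma ps_one_neq0 : (@ps_one F : pser F) != 0.
Proof.
by apply/eqP => /(congr1 (fun f : pser F => f 0%N)) /eqP; rewrite oner_eq0.
Qed.

HB.instance Definition _ := GRing.Zmodule_isComNzRing.Build (pser F)
  ps_mulA ps_mulC ps_mul1 ps_mulDl ps_one_neq0.

Lemma psD f g n : (f + g) n = f n + g n. Proof. by []. Qed.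
Lemma psB f g n : (f - g) n = f n - g n. Proof. by []. Qed.
Lemma ps1 n : (1 : pser F) n = (n == 0%N)%:R. Proof. by []. Qed.
Lemma psM f g n : (f * g) n = \sum_(i < n.+1) f i * g (n - i)%N.
Proof. by []. Qed.
Lemma ps_sum (I : Type) (r : seq I) (P : pred I) (f : I -> pser F) n :
  (\sum_(i <- r | P i) f i) n = \sum_(i <- r | P i) f i n.
Proof. exact: (big_morph (fun f : pser F => f n)). Qed.

Lemma ps_mulE f g : ps_mul f g = f * g. Proof. by []. Qed.
Lemma ps_expE f m : ps_exp f m = f ^+ m.
Proof. by elim: m => //= m IHm; rewrite exprS -IHm. Qed.

Lemma psM0 f g : (f * g) 0%N = f 0%N * g 0%N.
Proof. by rewrite psM big_ord1. Qed.

Lemma psX_small f m n : f 0%N = 0 -> (n < m)%N -> (f ^+ m) n = 0.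
Proof.
move=> f0; elim: m n => // m IHm n; rewrite ltnS => lenm.
rewrite exprS psM big_ord_recl f0 mul0r add0r big1 // => i _.
rewrite IHm ?mulr0 // (leq_trans _ lenm) // lift0.
by rewrite ltn_subrL (leq_ltn_trans _ (ltn_ord i)).
Qed.

Lemma ps_mulV f : f 0%N != 0 -> f * (ps_inv f : pser F) = 1.
Proof.
move=> f0; set c := f 0%N in f0 *.
pose g : pser F := fun i => ps_one F i - c^-1 * f i.
have g0 : g 0%N = 0 by rewrite /g /ps_one /= mulVf // subrr.
have fE n : f n = c * (1 - g) n by rewrite psB /g ps1; field.
apply/funext => n.
(* The power g^j starts at order j, so for all i <= n the sum may run to the common bound n; it is
   then a finite geometric series. *)
have invE i : (i <= n)%N -> ps_inv f i = c^-1 * (\sum_(j < n.+1) g ^+ j) i.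
  move=> lein; rewrite /ps_inv -/c -/g ps_sum; congr (_ * _).
  rewrite (big_ord_widen n.+1 (fun j => ps_exp g j i)) // big_mkcond /=.
  apply: eq_bigr => j _; rewrite ps_expE; case: ltnP => // ltij.
  by rewrite psX_small.
have -> : (f * (ps_inv f : pser F)) n = ((1 - g) * \sum_(j < n.+1) g ^+ j) n.
  rewrite !psM; apply: eq_bigr => i _.
  by rewrite fE invE ?leq_subr // mulrACA mulfV // mul1r.
have -> : (1 - g) * (\sum_(j < n.+1) g ^+ j) = 1 - g ^+ n.+1.
  by rewrite -(opprB g) mulNr -subrX1 opprB.
by rewrite psB psX_small // subr0.
Qed.

Lemma ps_inv_unique f g : f * g = 1 -> ps_inv f = g.
Proof.
move=> fg1; have f0 : f 0%N != 0.
  have /eqP := congr1 (fun u : pser F => u 0%N) fg1; rewrite psM0 ps1 => fg0.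
  by apply: contraTneq fg0 => ->; rewrite mul0r eq_sym oner_eq0.
rewrite -[RHS]mul1r -(ps_mulV f0) mulrAC fg1 mul1r //.
Qed.

(** Congruence modulo q^(N+1), under which infinite sums and products may be replaced by finite
    ones. *)
Definition eqm (N : nat) f g := forall i, (i <= N)%N -> f i = g i.

Lemma eqm_refl N f : eqm N f f. Proof. by []. Qed.
Lemma eqm_sym N f g : eqm N f g -> eqm N g f.
Proof. by move=> e i /e. Qed.
Lemma eqm_trans N f g h : eqm N f g -> eqm N g h -> eqm N f h.
Proof. by move=> e1 e2 i lei; rewrite e1 ?e2. Qed.
Lemma eqm_le N M f g : (M <= N)%N -> eqm N f g -> eqm M f g.
Proof. by move=> leMN e i lei; apply/e/(leq_trans lei). Qed.

Lemma eqmM N f f' g g' : eqm N f f' -> eqm N g g' -> eqm N (f * g) (f' * g').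
Proof.
move=> ef eg i lei; rewrite !psM; apply: eq_bigr => j _.
by rewrite ef ?eg // (leq_trans _ lei) ?leq_subr // -ltnS.
Qed.

Lemma eqmX N f g m : eqm N f g -> eqm N (f ^+ m) (g ^+ m).
Proof. by move=> e; elim: m => // m IHm; rewrite !exprS; apply: eqmM. Qed.

Lemma eqm_inv N f f' g g' :
  f * g = 1 -> f' * g' = 1 -> eqm N f f' -> eqm N g g'.
Proof.
move=> fg fg' ef; rewrite -[g]mulr1 -fg' -{2}[g']mul1r -fg mulrA.
by rewrite (mulrC g); apply: eqmM => //; apply: eqmM => //; apply: eqm_sym.
Qed.

Definition pps (p : {poly F}) : pser F := fun i => p`_i.

Lemma pps_is_zmod : zmod_morphism pps.
Proof. by move=> p r; apply/funext => i; rewrite /pps coefB. Qed.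
Lemma pps_is_monoid : monoid_morphism pps.
Proof.
split; first by apply/funext => i; rewrite /pps coef1.
by move=> p r; apply/funext => i; rewrite /pps coefM.
Qed.
HB.instance Definition _ :=
  GRing.isZmodMorphism.Build {poly F} (pser F) pps pps_is_zmod.
HB.instance Definition _ :=
  GRing.isMonoidMorphism.Build {poly F} (pser F) pps pps_is_monoid.

Definition psq : pser F := pps 'X.
Definition psC (c : F) : pser F := pps c%:P.

Lemma psC_is_zmod : zmod_morphism psC.
Proof. by move=> a b; rewrite /psC polyCB rmorphB. Qed.
Lemma psC_is_monoid : monoid_morphism psC.
Proof. by split=> [|a b]; rewrite /psC ?rmorph1 // polyCM rmorphM. Qed.
HB.instance Definition _ :=
  GRing.isZmodMorphism.Build F (pser F) psC psC_is_zmod.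
HB.instance Definition _ :=
  GRing.isMonoidMorphism.Build F (pser F) psC psC_is_monoid.

Lemma psCE c n : psC c n = if n == 0%N then c else 0.
Proof. by rewrite /psC /pps coefC. Qed.

Lemma psqXE k n : (psq ^+ k) n = (n == k)%:R.
Proof. by rewrite -rmorphXn /= /pps coefXn. Qed.

Lemma ps_mulC_coef c f n : (psC c * f) n = c * f n.
Proof.
rewrite psM big_ord_recl psCE subn0 big1 ?addr0 // => i _.
by rewrite psCE mul0r.
Qed.

Lemma ps_mulqX k f n :
  (psq ^+ k * f) n = if (k <= n)%N then f (n - k)%N else 0.
Proof.
rewrite psM; case: leqP => [lekn|ltnk]; last first.
  rewrite big1 // => i _; rewrite psqXE; case: eqP; last by rewrite mul0r.
  by move=> eik; move: (ltn_ord i); rewrite eik ltnS leqNgt ltnk.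
have ltk : (k < n.+1)%N by [].
rewrite (bigD1 (Ordinal ltk)) //= psqXE eqxx mul1r big1 ?addr0 // => i.
by rewrite -val_eqE /= psqXE => /negbTE ->; rewrite mul0r.
Qed.

Lemma eqm_mulqX N k f g :
  eqm N f g -> eqm (N + k) (psq ^+ k * f) (psq ^+ k * g).
Proof.
move=> e i lei; rewrite !ps_mulqX; case: leqP => // leki.
by apply: e; rewrite leq_subLR addnC.
Qed.

(* The sum of the series f n, provided that q ^ n divides f n (see [qsmall]). *)
Definition psum (f : nat -> pser F) : pser F :=
  fun N => \sum_(n < N.+1) f n N.

Definition qsmall (f : nat -> pser F) := forall n k, (k < n)%N -> f n k = 0.

Lemma psum_eqm (f : nat -> pser F) N M : qsmall f -> (N < M)%N ->
  eqm N (psum f) (\sum_(n < M) f n).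
Proof.
move=> sf ltNM i leiN; rewrite /psum ps_sum.
have leiM : (i.+1 <= M)%N by apply: leq_ltn_trans ltNM.
rewrite (big_ord_widen M (fun n => f n i)) // big_mkcond /=.
by apply: eq_bigr => j _; case: ltnP => // ltij; rewrite sf.
Qed.

Lemma qsmallM (f g : nat -> pser F) : qsmall f -> qsmall (fun n => g n * f n).
Proof.
move=> sf n k ltkn; rewrite psM big1 // => i _.
by rewrite sf ?mulr0 // (leq_ltn_trans _ ltkn) // leq_subr.
Qed.

Lemma qsmall_qX (e : nat -> nat) (g : nat -> pser F) : (forall n, n <= e n)%N ->
  qsmall (fun n => psq ^+ e n * g n).
Proof.
move=> le_e n k ltkn; rewrite ps_mulqX leqNgt.
by rewrite (leq_trans ltkn (le_e n)).
Qed.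

Lemma psum_mulr (f : nat -> pser F) g :
  qsmall f -> g * psum f = psum (fun n => g * f n).
Proof.
move=> sf; apply/funext => N.
have sgf : qsmall (fun n => g * f n) by apply: (@qsmallM f (fun=> g)).
rewrite (psum_eqm sgf (ltnSn N)) // -mulr_sumr.
by apply: (@eqmM N) (leqnn N) => //; apply: psum_eqm.
Qed.

Lemma eq_psum (f g : nat -> pser F) : (forall n, f n = g n) -> psum f = psum g.
Proof. by move=> e; apply/funext => N; rewrite /psum; apply: eq_bigr => i _;
rewrite e. Qed.

End PowerSeriesRing.

Arguments psq {F}.

Section MapSeries.
Variables (F F' : fieldType) (phi : {rmorphism F -> F'}).

(** Used to prove positivity over the ordered field [rat] and to transport the series to [Qs], where
    there is no order to appeal to. *)
Definition psmap (f : pser F) : pser F' := fun n => phi (f n).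

Lemma psmap_is_zmod : zmod_morphism psmap.
Proof. by move=> f g; apply/funext => n; rewrite /psmap psB rmorphB. Qed.
Lemma psmap_is_monoid : monoid_morphism psmap.
Proof.
split=> [|f g]; apply/funext => n; rewrite /psmap.
  by rewrite !ps1 rmorph_nat.
by rewrite psM rmorph_sum; apply: eq_bigr => i _; rewrite rmorphM.
Qed.
HB.instance Definition _ :=
  GRing.isZmodMorphism.Build (pser F) (pser F') psmap psmap_is_zmod.
HB.instance Definition _ :=
  GRing.isMonoidMorphism.Build (pser F) (pser F') psmap psmap_is_monoid.

Lemma psmap_q : psmap psq = psq.
Proof. by apply/funext => n; rewrite /psmap /psq /pps !coefX rmorph_nat. Qed.

Lemma psmap_psC c : psmap (psC c) = psC (phi c).
Proof.
by apply/funext => n; rewrite /psmap !psCE; case: ifP; rewrite ?rmorph0.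
Qed.

Lemma psmap_psum f : psmap (psum f) = psum (fun n => psmap (f n)).
Proof. by apply/funext => N; rewrite /psmap /psum rmorph_sum. Qed.

Lemma psmap_inv f : f 0%N != 0 -> psmap (ps_inv f) = ps_inv (psmap f).
Proof.
move=> f0; apply/esym/ps_inv_unique.
by rewrite -rmorphM /= ps_mulV // rmorph1.
Qed.

Lemma psmap_qpoch : psmap (qpoch 'X) = qpoch 'X.
Proof.
apply/funext => n; rewrite /psmap /qpoch.
transitivity ((map_poly phi (\prod_(j < n.+1) (1 - 'X * 'X^j)))`_n).
  by rewrite coef_map.
congr ((_ : {poly F'})`_n); rewrite rmorph_prod; apply: eq_bigr => j _.
by rewrite rmorphB rmorph1 rmorphM /= map_polyXn map_polyX.
Qed.

End MapSeries.

(** * Positivity of the inverse q-Pochhammer symbol *)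

Section Pochhammer.
Variable F : fieldType.

Definition qprod (c : F) m : pser F :=
  \prod_(i < m) (1 - psC c * psq ^+ i.+1).

(** The new factor 1 - c q^(m+1) is congruent to 1 modulo q^(m+1). *)
Lemma qprod_succ c m : eqm m (qprod c m) (qprod c m.+1).
Proof.
move=> i leim; rewrite /qprod big_ord_recr /= mulrBr mulr1 psB.
rewrite mulrA -(mulrC (psq ^+ m.+1)) ps_mulqX.
by rewrite ltnNge leim subr0.
Qed.

Lemma qprod_stable c m k : eqm m (qprod c m) (qprod c (m + k)).
Proof.
elim: k => [|k IHk]; first by rewrite addn0.
apply: eqm_trans IHk _; apply: (@eqm_le _ (m + k)); first exact: leq_addr.
by rewrite addnS; apply: qprod_succ.
Qed.

Lemma qpoch_qprod c N m : (N <= m)%N -> eqm N (qpoch (c *: 'X)) (qprod c m).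
Proof.
move=> leNm n lenN; rewrite /qpoch.
transitivity (qprod c n.+1 n); last first.
  rewrite -(@qprod_succ c n n) //.
  by rewrite -(subnKC (leq_trans lenN leNm)); apply: qprod_stable.
transitivity (pps (\prod_(j < n.+1) (1 - c *: 'X * 'X^j)) n) => //.
rewrite rmorph_prod; congr ((_ : pser F) n); apply: eq_bigr => j _.
rewrite rmorphB rmorph1 rmorphM /= -mul_polyC rmorphM /= exprS.
by rewrite -!mulrA -rmorphXn.
Qed.

(** In the usual notation, [poch] is (q; q)_oo, [ipoch] is the generating series of partitions and
    [pochn m] is (q; q)_m. *)
Definition poch : pser F := qpoch 'X.
Definition ipoch : pser F := ps_inv poch.
Definition pochn m : pser F := \prod_(i < m) (1 - psq ^+ i.+1).

Lemma poch_pochn N m : (N <= m)%N -> eqm N poch (pochn m).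
Proof.
have -> : pochn m = qprod 1 m.
  by apply: eq_bigr => i _; rewrite rmorph1 mul1r.
by rewrite /poch -[X in qpoch X]scale1r; apply: qpoch_qprod.
Qed.

Lemma poch0 : poch 0%N = 1.
Proof. by rewrite (@poch_pochn 0 0) // /pochn big_ord0 ps1. Qed.

Lemma poch_ipoch : poch * ipoch = 1.
Proof. by apply: ps_mulV; rewrite poch0 oner_eq0. Qed.

Lemma ipoch0 : ipoch 0%N = 1.
Proof.
have := congr1 (fun f : pser F => f 0%N) poch_ipoch.
by rewrite psM0 poch0 mul1r ps1.
Qed.

(** For j > 0 this is the geometric series 1 / (1 - q^j). *)
Definition geo j : pser F := fun n => (j %| n)%:R.

Lemma geoP j : (0 < j)%N -> (1 - psq ^+ j) * geo j = 1.
Proof.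
move=> j0; apply/funext => n; rewrite mulrBl mul1r psB ps_mulqX ps1 /geo.
case: leqP => [lejn|ltnj]; first rewrite dvdn_subl // subrr.
  by rewrite -leqn0 leqNgt (leq_trans j0 lejn).
rewrite subr0; case: n ltnj => [|n] ltnj; first by rewrite dvdn0.
by rewrite gtnNdvd.
Qed.

Lemma geo1E n : geo 1 n = 1. Proof. by rewrite /geo dvd1n. Qed.

(** Multiplying by 1 - q^j removes one factor of the product of all 1 / (1 - q^i), which leaves
    visibly nonnegative coefficients. The cut n + j is large enough both to contain the factor j and
    to be exact at order n. *)
Lemma ipoch_pochn_mul j n : (0 < j)%N ->
  ((1 - psq ^+ j) * ipoch) n = (\prod_(i < n + j | i.+1 != j) geo i.+1) n.
Proof.
move=> j0; set Q := \prod_(i < _ | _) _.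
pose R : pser F := \prod_(i < n + j | i.+1 != j) (1 - psq ^+ i.+1).
have RQ : R * Q = 1 by rewrite -big_split big1 //= => i _; rewrite geoP.
have ltj : (j.-1 < n + j)%N by rewrite prednK // leq_addl.
have pE : pochn (n + j) = (1 - psq ^+ j) * R.
  rewrite /pochn (bigD1 (Ordinal ltj)) //= prednK //; congr (_ * _).
  by apply: eq_bigl => i; rewrite -val_eqE /=; move: (nat_of_ord i) => a;
    rewrite -[in RHS](prednK j0) eqSS.
have -> : (1 - psq ^+ j) * ipoch = Q * (pochn (n + j) * ipoch).
  transitivity (R * Q * ((1 - psq ^+ j) * ipoch)); first by rewrite RQ mul1r.
  by rewrite pE; ring.
rewrite -[in RHS](mulr1 Q) -poch_ipoch; apply: (@eqmM _ n) => //.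
by apply: eqmM => //; apply/eqm_sym/poch_pochn/leq_addr.
Qed.

Lemma geo1_ipoch : ipoch = geo 1 * ((1 - psq) * ipoch).
Proof. by rewrite mulrA (mulrC (geo 1)) -[psq]expr1 geoP // mul1r. Qed.

Definition binser k : pser F := fun n => 'C(n + k, k)%:R.

(** The negative binomial series: after cancelling 1 / (1 - q), the induction step is Pascal's
    rule. *)
Lemma geo1X k : geo 1 ^+ k.+1 = binser k.
Proof.
elim: k => [|k IHk].
  by apply/funext => n; rewrite expr1 geo1E /binser bin0.
rewrite exprS IHk -[RHS]mul1r -(geoP (ltn0Sn 0)) -mulrA mulrCA; congr (_ * _).
apply/funext => n; rewrite mulrBl mul1r psB ps_mulqX /binser.
case: n => [|n] /=; first by rewrite !add0n !binn subr0.
by rewrite subn1 /= addnS binS addSnnS natrD addrC addKr.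
Qed.

End Pochhammer.

Arguments poch {F}.
Arguments ipoch {F}.

Lemma psmap_poch (F F' : fieldType) (phi : {rmorphism F -> F'}) :
  psmap phi poch = poch.
Proof. exact: psmap_qpoch. Qed.

Lemma psmap_ipoch (F F' : fieldType) (phi : {rmorphism F -> F'}) :
  psmap phi ipoch = ipoch.
Proof. by rewrite /ipoch psmap_inv ?psmap_poch // poch0 oner_eq0. Qed.

(** * Coefficientwise positivity *)

Definition ps_ge0 (f : pser rat) := forall n, 0 <= f n.
Definition ps_gt0 (f : pser rat) := forall n, 0 < f n.

Lemma ps_gt0W f : ps_gt0 f -> ps_ge0 f.
Proof. by move=> f0 n; apply: ltW. Qed.

Lemma ps_ge0D f g : ps_ge0 f -> ps_ge0 g -> ps_ge0 (f + g).
Proof. by move=> f0 g0 n; rewrite psD addr_ge0. Qed.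

Lemma ps_ge0M f g : ps_ge0 f -> ps_ge0 g -> ps_ge0 (f * g).
Proof. by move=> f0 g0 n; rewrite psM sumr_ge0 // => i _; rewrite mulr_ge0. Qed.

Lemma ps_ge01 : ps_ge0 1.
Proof. by move=> n; rewrite ps1 ler0n. Qed.

Lemma ps_ge0X f m : ps_ge0 f -> ps_ge0 (f ^+ m).
Proof.
move=> f0; elim: m => [|m IHm]; first exact: ps_ge01.
by rewrite exprS; apply: ps_ge0M.
Qed.

Lemma ps_ge0q : ps_ge0 psq.
Proof. by move=> n; rewrite -[psq]expr1 psqXE ler0n. Qed.

Lemma ps_ge0C c : 0 <= c -> ps_ge0 (psC c).
Proof. by move=> c0 n; rewrite psCE; case: ifP. Qed.

Lemma ps_gt0M f g : ps_gt0 f -> ps_ge0 g -> 0 < g 0%N -> ps_gt0 (f * g).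
Proof.
move=> f0 g0 g00 n; rewrite psM big_ord_recr /= subnn ltr_pwDr //.
  by rewrite mulr_gt0.
by rewrite sumr_ge0 // => i _; rewrite mulr_ge0 // ltW.
Qed.

Lemma ps_ge0_geo j : ps_ge0 (geo rat j).
Proof. by move=> n; rewrite ler0n. Qed.

Lemma ipoch_diff_ge0 j : (0 < j)%N -> ps_ge0 ((1 - psq ^+ j) * ipoch).
Proof.
move=> j0 n; rewrite ipoch_pochn_mul //.
have: ps_ge0 (\prod_(i < n + j | i.+1 != j) geo rat i.+1); last exact.
by apply: big_ind => [|f g|i _];
  [exact: ps_ge01 | exact: ps_ge0M | exact: ps_ge0_geo].
Qed.

Lemma ipoch_diff0 j : (0 < j)%N -> (((1 - psq ^+ j) * ipoch) 0%N : rat) = 1.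
Proof.
move=> j0; rewrite psM0 ipoch0 mulr1 psB psqXE ps1.
by rewrite eq_sym (gtn_eqF j0) subr0.
Qed.

(** The factor 1 / (1 - q) has all coefficients equal to 1, and the remaining factor is nonnegative
    with constant term 1. *)
Lemma ipoch_gt0 : ps_gt0 ipoch.
Proof.
rewrite geo1_ipoch -[X in 1 - X]expr1; apply: ps_gt0M.
- by move=> n; rewrite geo1E.
- exact: ipoch_diff_ge0.
- by rewrite ipoch_diff0.
Qed.

Lemma ipoch_ge0 : ps_ge0 ipoch. Proof. exact/ps_gt0W/ipoch_gt0. Qed.

Lemma ipochX_gt0 k : ps_gt0 (ipoch ^+ k.+1).
Proof.
elim: k => [|k IHk]; first exact: ipoch_gt0.
by rewrite exprSr; apply: ps_gt0M; rewrite ?ipoch0 //; apply: ipoch_ge0.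
Qed.

Lemma ipochX_diff_ge0 j k : ps_ge0 ((1 - psq ^+ j) * ipoch ^+ k.+1).
Proof.
case: j => [|j]; first by move=> n; rewrite expr0 subrr mul0r.
by rewrite (exprS ipoch) mulrA; apply: ps_ge0M;
  [apply: ipoch_diff_ge0 | apply/ps_ge0X/ipoch_ge0].
Qed.

(** One inverse factor absorbs 1 - q^j and at least one more is kept for strict positivity, whence
    the exponent k + 2. *)
Lemma ipochX_diff_gt0 j k : (0 < j)%N ->
  ps_gt0 ((1 - psq ^+ j) * ipoch ^+ k.+2).
Proof.
move=> j0; rewrite (exprS ipoch) mulrA mulrC; apply: ps_gt0M.
- exact: ipochX_gt0.
- exact: ipoch_diff_ge0.
- by rewrite ipoch_diff0.
Qed.

(** Since [ipoch] is [geo rat 1] times a nonnegative series, k of the inverse factors can be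
    weakened to 1 / (1 - q), whose powers have polynomial coefficients. *)
Lemma ipoch_geo1 f k m : ps_ge0 (f * geo rat 1 ^+ k) ->
  ps_ge0 (f * ipoch ^+ (k + m)).
Proof.
move=> f0; rewrite exprD {1}geo1_ipoch exprMn !mulrA -mulrA.
apply: ps_ge0M => //; apply: ps_ge0M; apply: ps_ge0X; last exact: ipoch_ge0.
exact: (@ipoch_diff_ge0 1).
Qed.

(** * The inequalities between the moments *)

Section ThetaMoments.
Variable F : fieldType.

(* The sums of l ^ 2 q ^ floor(l ^ 2 / 4) over odd and over even l > 0. *)
Definition oddmoment : pser F :=
  psum (fun j => psq ^+ (j * j.+1) * psC ((2 * j + 1) ^ 2)%:R).
Definition evenmoment : pser F :=
  psum (fun j => psq ^+ (j.+1 * j.+1) * psC ((2 * j + 2) ^ 2)%:R).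

(** Only the m exponents e j <= n contribute at order n. The function [h] interpolates the
    coefficients of [f] on the field, which turns truncated subtraction of indices into genuine
    subtraction and makes the sum accessible to [field]. *)
Lemma psum_mul_coef (e : nat -> nat) (c : nat -> F) (f : pser F) h n m :
    (forall j, j <= e j)%N -> (forall j, j < m -> e j <= n)%N ->
    (forall j, m <= j -> n < e j)%N -> (forall k, f k = h (k%:R : F)) ->
  (psum (fun j => psq ^+ e j * psC (c j)) * f) n =
  \sum_(j < m) c j * h (n%:R - (e j)%:R).
Proof.
move=> lee lt_m ge_m fE; rewrite mulrC psum_mulr; last exact: qsmall_qX.
have lemn : (m <= n.+1)%N.
  by rewrite leqNgt; apply/negP => /lt_m; rewrite leqNgt lee.
rewrite [RHS](big_ord_widen n.+1 (fun j => c j * h (n%:R - (e j)%:R))) //.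
rewrite [RHS]big_mkcond; apply: eq_bigr => j _.
rewrite mulrCA ps_mulqX mulrC; case: ltnP => [/lt_m lejn|/ge_m].
  by rewrite lejn ps_mulC_coef fE natrB.
by rewrite ltnNge => /negbTE ->.
Qed.

Lemma psq_oddmoment : psq * oddmoment =
  psum (fun j => psq ^+ (j * j.+1).+1 * psC ((2 * j + 1) ^ 2)%:R).
Proof.
rewrite psum_mulr; last by apply: qsmall_qX => j; rewrite leq_pmulr.
by apply: eq_psum => j; rewrite mulrA -exprS.
Qed.

End ThetaMoments.

Arguments oddmoment {F}.
Arguments evenmoment {F}.

Lemma psmap_oddmoment (F F' : fieldType) (phi : {rmorphism F -> F'}) :
  psmap phi oddmoment = oddmoment.
Proof.
rewrite psmap_psum; apply: eq_psum => j.
by rewrite rmorphM rmorphXn /= psmap_q psmap_psC rmorph_nat.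
Qed.

Lemma psmap_evenmoment (F F' : fieldType) (phi : {rmorphism F -> F'}) :
  psmap phi evenmoment = evenmoment.
Proof.
rewrite psmap_psum; apply: eq_psum => j.
by rewrite rmorphM rmorphXn /= psmap_q psmap_psC rmorph_nat.
Qed.

(** The exponents j(j+1) and (j+1)^2 of the two moments interlace. On each of the two kinds of
    interval, from m^2 to m^2 + m - 1 and from m^2 + m to (m+1)^2 - 1, the set of contributing
    exponents is constant. *)
Lemma sqrt_decomposition n : exists m r : nat,
  (n = m * m + r /\ r < m)%N \/ (n = m * m + m + r /\ r <= m)%N.
Proof.
elim: n => [|n [m [r IHn]]]; first by exists 0%N, 0%N; right.
case: IHn => [[-> ltrm]|[-> lerm]].
  have [eqrm|nerm] := eqVneq r.+1 m; first by exists m, 0%N; right; lia.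
  by exists m, r.+1; left; lia.
have [eqrm|nerm] := eqVneq r m; first by exists m.+1, 0%N; left; lia.
by exists m, r.+1; right; lia.
Qed.

(** Polynomial forms of the coefficients of (1-q)^-4 and (1-q)^-3. *)
Definition tetrahedral (x : rat) : rat := (x + 1) * (x + 2) * (x + 3) / 6.
Definition triangular (x : rat) : rat := (x + 1) * (x + 2) / 2.

Lemma geo1X4E n : (geo rat 1 ^+ 4) n = tetrahedral n%:R.
Proof.
rewrite geo1X /binser; have := bin_ffact (n + 3) 3.
move/(congr1 (fun k => k%:R : rat)); rewrite natrM.
rewrite !ffactnS ffactn0 !natrM addn3 /= => e.
apply: (@mulIf _ (3`!)%:R) => //; rewrite e /tetrahedral.
rewrite -[n.+3]addn3 -[n.+2]addn2 -[n.+1]addn1 !natrD.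
by have -> : (3`!)%:R = 6 :> rat by []; field.
Qed.

Lemma geo1X3E n : (geo rat 1 ^+ 3) n = triangular n%:R.
Proof.
rewrite geo1X /binser; have := bin_ffact (n + 2) 2.
move/(congr1 (fun k => k%:R : rat)); rewrite natrM.
rewrite !ffactnS ffactn0 !natrM addn2 /= => e.
apply: (@mulIf _ (2`!)%:R) => //; rewrite e /triangular.
rewrite -[n.+2]addn2 -[n.+1]addn1 !natrD.
by have -> : (2`!)%:R = 2 :> rat by []; field.
Qed.

(* Syntax directed, so that rational numerals never get evaluated. *)
Ltac poly_ge0 :=
  lazymatch goal with
  | |- is_true (0 <= (?a + ?b)%R) => apply: (@addr_ge0 _ a b); poly_ge0
  | |- is_true (0 <= (?a / _)%R) =>
      apply: (@mulr_ge0 _ a); [poly_ge0 | rewrite invr_ge0; exact: ler0n]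
  | |- is_true (0 <= (?a * ?b)%R) => apply: (@mulr_ge0 _ a b); poly_ge0
  | |- is_true (0 <= (?a ^+ ?k)%R) => apply: (@exprn_ge0 _ k a); poly_ge0
  | |- is_true (0 <= _%:R) => exact: ler0n
  | _ => assumption
  end.

(* The two closed forms of partial sums below were found by interpolation. Each
   positivity lemma substitutes m = r + e + 1, after which all the coefficients
   are nonnegative. *)
Definition odd_minus_even (m x : rat) : rat :=
  (- 407 * m - 553 * m * x - 245 * m * x ^+ 2 - 35 * m * x ^+ 3 -
   420 * m ^+ 2 - 770 * m ^+ 2 * x - 420 * m ^+ 2 * x ^+ 2 -
   70 * m ^+ 2 * x ^+ 3 + 1330 * m ^+ 3 + 1155 * m ^+ 3 * x +
   245 * m ^+ 3 * x ^+ 2 + 770 * m ^+ 4 + 840 * m ^+ 4 * x +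
   210 * m ^+ 4 * x ^+ 2 - 868 * m ^+ 5 - 357 * m ^+ 5 * x - 420 * m ^+ 6
   - 210 * m ^+ 6 * x + 155 * m ^+ 7 + 70 * m ^+ 8) / 210.

Lemma odd_minus_evenE m (x : rat) :
  \sum_(j < m) ((2 * j + 1) ^ 2)%:R * tetrahedral (x - (j * j.+1)%:R)
  - \sum_(j < m) ((2 * j + 2) ^ 2)%:R * tetrahedral (x - (j.+1 * j.+1)%:R)
  = odd_minus_even m%:R x.
Proof.
elim: m => [|m IHm].
  by rewrite !big_ord0 /odd_minus_even; field.
rewrite !big_ord_recr /= opprD addrACA IHm /odd_minus_even /tetrahedral.
by rewrite -[m.+1]addn1 !(natrX, natrM, natrD); field.
Qed.

Lemma odd_minus_even_ge0_lt (r e : rat) : 0 <= r -> 0 <= e ->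
  0 <= odd_minus_even (r + e + 1) ((r + e + 1) ^+ 2 + r).
Proof.
move=> r0 e0; rewrite /odd_minus_even.
rewrite [X in 0 <= X](_ : _ =
    (1350 * e + 2499 * e ^+ 2 + 1477 * e ^+ 3 + 490 * e ^+ 4 + 210 * e ^+ 5
    + 56 * e ^+ 6 + 8 * e ^+ 7 + 720 * r + 5040 * r * e +
    5936 * r * e ^+ 2 + 2905 * r * e ^+ 3 + 1190 * r * e ^+ 4 +
    364 * r * e ^+ 5 + 56 * r * e ^+ 6 + 2016 * r ^+ 2 + 6776 * r ^+ 2 * e
    + 5775 * r ^+ 2 * e ^+ 2 + 2800 * r ^+ 2 * e ^+ 3 +
    980 * r ^+ 2 * e ^+ 4 + 168 * r ^+ 2 * e ^+ 5 + 2212 * r ^+ 3 +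
    4620 * r ^+ 3 * e + 3290 * r ^+ 3 * e ^+ 2 + 1400 * r ^+ 3 * e ^+ 3 +
    280 * r ^+ 3 * e ^+ 4 + 1260 * r ^+ 4 + 1890 * r ^+ 4 * e +
    1120 * r ^+ 4 * e ^+ 2 + 280 * r ^+ 4 * e ^+ 3 + 420 * r ^+ 5 +
    476 * r ^+ 5 * e + 168 * r ^+ 5 * e ^+ 2 + 84 * r ^+ 6 +
    56 * r ^+ 6 * e + 8 * r ^+ 7) / 210); last by field.
by poly_ge0.
Qed.

(** The end point r = m of the second range, which m = r + e + 1 with e >= 0 misses. The added
    summand is the odd term j = m, present from n = m^2 + m on. *)
Lemma odd_minus_even_ge0_eq (r : rat) : 0 <= r ->
  0 <= odd_minus_even r (r ^+ 2 + r + r) + (2 * r + 1) ^+ 2 * tetrahedral r.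
Proof.
move=> r0; rewrite /odd_minus_even /tetrahedral.
rewrite [X in 0 <= X](_ : _ =
    (105 + 409 * r + 532 * r ^+ 2 + 336 * r ^+ 3 + 175 * r ^+ 4 +
    91 * r ^+ 5 + 28 * r ^+ 6 + 4 * r ^+ 7) / 105); last by field.
by poly_ge0.
Qed.

Lemma odd_minus_even_ge0_le (r e : rat) : 0 <= r -> 0 <= e ->
  0 <= odd_minus_even (r + e + 1) ((r + e + 1) ^+ 2 + (r + e + 1) + r)
       + (2 * (r + e + 1) + 1) ^+ 2 * tetrahedral r.
Proof.
move=> r0 e0; rewrite /odd_minus_even /tetrahedral.
rewrite [X in 0 <= X](_ : _ =
    (630 + 1077 * e + 2121 * e ^+ 2 + 2562 * e ^+ 3 + 1470 * e ^+ 4 +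
    448 * e ^+ 5 + 84 * e ^+ 6 + 8 * e ^+ 7 + 2547 * r + 5369 * r * e +
    7826 * r * e ^+ 2 + 6160 * r * e ^+ 3 + 2450 * r * e ^+ 4 +
    532 * r * e ^+ 5 + 56 * r * e ^+ 6 + 4298 * r ^+ 2 + 8981 * r ^+ 2 * e
    + 9765 * r ^+ 2 * e ^+ 2 + 5250 * r ^+ 2 * e ^+ 3 +
    1400 * r ^+ 2 * e ^+ 4 + 168 * r ^+ 2 * e ^+ 5 + 3927 * r ^+ 3 +
    7175 * r ^+ 3 * e + 5600 * r ^+ 3 * e ^+ 2 + 1960 * r ^+ 3 * e ^+ 3 +
    280 * r ^+ 3 * e ^+ 4 + 2100 * r ^+ 4 + 3010 * r ^+ 4 * e +
    1540 * r ^+ 4 * e ^+ 2 + 280 * r ^+ 4 * e ^+ 3 + 658 * r ^+ 5 +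
    644 * r ^+ 5 * e + 168 * r ^+ 5 * e ^+ 2 + 112 * r ^+ 6 +
    56 * r ^+ 6 * e + 8 * r ^+ 7) / 210); last by field.
by poly_ge0.
Qed.

Definition even_minus_odd (m x : rat) : rat :=
  (11 * m + 15 * m * x + 5 * m * x ^+ 2 + 20 * m ^+ 2 + 30 * m ^+ 2 * x +
   10 * m ^+ 2 * x ^+ 2 - 20 * m ^+ 3 - 10 * m ^+ 3 * x - 30 * m ^+ 4 -
   20 * m ^+ 4 * x + 9 * m ^+ 5 + 10 * m ^+ 6) / 10.

Lemma even_minus_oddE m (x : rat) :
  \sum_(j < m) ((2 * j + 2) ^ 2)%:R * triangular (x - (j.+1 * j.+1)%:R)
  - \sum_(j < m) ((2 * j + 1) ^ 2)%:R * triangular (x - (j * j.+1).+1%:R)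
  = even_minus_odd m%:R x.
Proof.
elim: m => [|m IHm].
  by rewrite !big_ord0 /even_minus_odd; field.
rewrite !big_ord_recr /= opprD addrACA IHm /even_minus_odd /triangular.
by rewrite -[m.+1]addn1 -[_.+1]addn1 !(natrX, natrM, natrD); field.
Qed.

(** Here the variable stands for m, at n = m^2 + m: the last order before the odd term j = m,
    shifted by one, comes in. *)
Lemma even_minus_odd_ge0_eq (r : rat) : 0 <= r ->
  0 <= even_minus_odd r (r ^+ 2 + r).
Proof.
move=> r0; rewrite /even_minus_odd.
rewrite [X in 0 <= X](_ : _ =
    (11 * r + 35 * r ^+ 2 + 30 * r ^+ 3 + 10 * r ^+ 4 + 4 * r ^+ 5) / 10);
      last by field.
by poly_ge0.
Qed.

Lemma even_minus_odd_ge0_lt (r e : rat) : 0 <= r -> 0 <= e ->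
  0 <= even_minus_odd (r + e + 1) ((r + e + 1) ^+ 2 + r).
Proof.
move=> r0 e0; rewrite /even_minus_odd.
rewrite [X in 0 <= X](_ : _ =
    (30 + 56 * e + 45 * e ^+ 2 + 35 * e ^+ 3 + 20 * e ^+ 4 + 4 * e ^+ 5 +
    101 * r + 165 * r * e + 135 * r * e ^+ 2 + 80 * r * e ^+ 3 +
    20 * r * e ^+ 4 + 135 * r ^+ 2 + 190 * r ^+ 2 * e +
    130 * r ^+ 2 * e ^+ 2 + 40 * r ^+ 2 * e ^+ 3 + 90 * r ^+ 3 +
    100 * r ^+ 3 * e + 40 * r ^+ 3 * e ^+ 2 + 30 * r ^+ 4 +
    20 * r ^+ 4 * e + 4 * r ^+ 5) / 10); last by field.
by poly_ge0.
Qed.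

(** Now r counts from m^2 + m + 1, where the odd term j = m enters with a minus sign. *)
Lemma even_minus_odd_ge0_gt (r e : rat) : 0 <= r -> 0 <= e ->
  0 <= even_minus_odd (r + e + 1) ((r + e + 1) ^+ 2 + (r + e + 1) + 1 + r)
       - (2 * (r + e + 1) + 1) ^+ 2 * triangular r.
Proof.
move=> r0 e0; rewrite /even_minus_odd /triangular.
rewrite [X in 0 <= X](_ : _ =
    (90 + 291 * e + 295 * e ^+ 2 + 130 * e ^+ 3 + 30 * e ^+ 4 + 4 * e ^+ 5
    + 261 * r + 615 * r * e + 450 * r * e ^+ 2 + 140 * r * e ^+ 3 +
    20 * r * e ^+ 4 + 290 * r ^+ 2 + 475 * r ^+ 2 * e +
    230 * r ^+ 2 * e ^+ 2 + 40 * r ^+ 2 * e ^+ 3 + 155 * r ^+ 3 +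
    160 * r ^+ 3 * e + 40 * r ^+ 3 * e ^+ 2 + 40 * r ^+ 4 +
    20 * r ^+ 4 * e + 4 * r ^+ 5) / 10); last by field.
by poly_ge0.
Qed.

Lemma odd_sub_even_ge0 :
  ps_ge0 ((oddmoment - evenmoment) * geo rat 1 ^+ 4).
Proof.
move=> n; rewrite mulrBl psB /oddmoment /evenmoment.
have [m [r [[def_n ltrm]|[def_n lerm]]]] := sqrt_decomposition n.
  rewrite !(psum_mul_coef (m := m) _ _ _ _ geo1X4E); try by move=> j; nia.
  rewrite odd_minus_evenE.
  have := @odd_minus_even_ge0_lt r%:R (m - r.+1)%:R.
  have -> : r%:R + (m - r.+1)%:R + 1 = m%:R :> rat.
    by rewrite -natrD natr1; congr (_%:R); lia.
  by rewrite -natrX -natrD -mulnn -def_n; apply; rewrite ler0n.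
(* In the second range there is one odd term more than there are even ones, and j = m is split off
   from the closed form. *)
rewrite (psum_mul_coef (m := m.+1) _ _ _ _ geo1X4E); try by move=> j; nia.
rewrite (psum_mul_coef (m := m) _ _ _ _ geo1X4E); try by move=> j; nia.
rewrite big_ord_recr /= addrAC odd_minus_evenE.
have -> : n%:R - (m * m.+1)%:R = r%:R :> rat.
  by rewrite -natrB; [congr (_%:R); nia | nia].
have -> : ((2 * m + 1) ^ 2)%:R = (2 * m%:R + 1) ^+ 2 :> rat.
  by rewrite natrX natrD natrM.
have [eqrm|nerm] := eqVneq r m.
  have := @odd_minus_even_ge0_eq m%:R.
  by rewrite def_n eqrm !natrD natrM -expr2; apply; rewrite ler0n.
have := @odd_minus_even_ge0_le r%:R (m - r.+1)%:R.
have -> : r%:R + (m - r.+1)%:R + 1 = m%:R :> rat.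
  by rewrite -natrD natr1; congr (_%:R); lia.
by rewrite def_n !natrD natrM -expr2; apply; rewrite ler0n.
Qed.

Lemma even_sub_odd_ge0 :
  ps_ge0 ((evenmoment - psq * oddmoment) * geo rat 1 ^+ 3).
Proof.
move=> n; rewrite mulrBl psB psq_oddmoment /evenmoment.
have [m [r [[def_n ltrm]|[def_n lerm]]]] := sqrt_decomposition n.
  rewrite !(psum_mul_coef (m := m) _ _ _ _ geo1X3E); try by move=> j; nia.
  rewrite even_minus_oddE.
  have := @even_minus_odd_ge0_lt r%:R (m - r.+1)%:R.
  have -> : r%:R + (m - r.+1)%:R + 1 = m%:R :> rat.
    by rewrite -natrD natr1; congr (_%:R); lia.
  by rewrite -natrX -natrD -mulnn -def_n; apply; rewrite ler0n.
(* The factor q delays the odd term j = m to order m^2 + m + 1, so n = m^2 + m is treated apart. *)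
case: r def_n lerm => [|r] def_n ltrm.
  rewrite !(psum_mul_coef (m := m) _ _ _ _ geo1X3E); try by move=> j; nia.
  rewrite even_minus_oddE def_n addn0 natrD natrM -expr2.
  by apply: even_minus_odd_ge0_eq; rewrite ler0n.
rewrite (psum_mul_coef (m := m) _ _ _ _ geo1X3E); try by move=> j; nia.
rewrite (psum_mul_coef (m := m.+1) _ _ _ _ geo1X3E); try by move=> j; nia.
rewrite big_ord_recr /= opprD addrA even_minus_oddE.
have -> : n%:R - (m * m.+1).+1%:R = r%:R :> rat.
  by rewrite -natrB; [congr (_%:R); nia | nia].
have -> : ((2 * m + 1) ^ 2)%:R = (2 * m%:R + 1) ^+ 2 :> rat.
  by rewrite natrX natrD natrM.
have := @even_minus_odd_ge0_gt r%:R (m - r.+1)%:R.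
have -> : r%:R + (m - r.+1)%:R + 1 = m%:R :> rat.
  by rewrite -natrD natr1; congr (_%:R); lia.
have -> : m%:R ^+ 2 + m%:R + 1 + r%:R = n%:R :> rat.
  by rewrite -natrX -natrD natr1 -natrD; congr (_%:R); nia.
by apply; rewrite ler0n.
Qed.

(** * The field of rational functions in s *)

HB.instance Definition _ :=
  GRing.RMorphism.copy ratfun (@FracField.tofrac {poly rat}).

Lemma ratfun_eq0 p : (ratfun p == 0) = (p == 0).
Proof. exact: tofrac_eq0. Qed.

Lemma ratfun_inj : injective ratfun.
Proof. by move=> p r /eqP; rewrite /ratfun tofrac_eq => /eqP. Qed.

Lemma denom_neq0 f : denom f != 0.
Proof. exact: denom_ratioP. Qed.

Lemma denomP f : f * ratfun (denom f) = ratfun (numer f).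
Proof.
rewrite /ratfun /denom /numer -[f in f * _]reprK; unlock FracField.tofrac.
rewrite -[LHS]FracField.pi_mul; apply/eqP; rewrite FracField.equivf_def.
rewrite /FracField.equivf /FracField.mulf /= !numden_Ratio ?mulr1 ?oner_neq0
  ?denom_ratioP //.
by rewrite mulrC.
Qed.

Lemma sqrty_neq0 : sqrty != 0.
Proof. by rewrite ratfun_eq0 polyX_eq0. Qed.

(** The quotient rule gives the same value on every representative, not only on the one chosen by
    [numer] and [denom]: differentiate N Q = P D and cross-multiply. *)
Lemma dsE f P Q : Q != 0 -> f * ratfun Q = ratfun P ->
  ds f = ratfun (P^`() * Q - P * Q^`()) / ratfun Q ^+ 2.
Proof.
move=> Q0 fQ; rewrite /ds; set N := numer f; set D := denom f.
have D0 : D != 0 by apply: denom_neq0.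
have NQ : N * Q = P * D.
  by apply: ratfun_inj; rewrite !rmorphM /= -fQ -denomP; ring.
have dNQ : N^`() * Q + N * Q^`() = P^`() * D + P * D^`().
  by rewrite -!derivM NQ.
apply/eqP; rewrite eqr_div ?expf_neq0 ?ratfun_eq0 //.
rewrite -!rmorphXn -!rmorphM; apply/eqP; congr ratfun.
have -> : (N^`() * D - N * D^`()) * Q ^+ 2 =
  (N^`() * Q + N * Q^`()) * D * Q - (N * Q) * (D * Q^`() + D^`() * Q) by ring.
by rewrite dNQ NQ; ring.
Qed.

(** The derivatives are free variables here, which leaves a plain field identity. *)
Lemma quotient_ruleD (F : fieldType) (a b c d a' b' c' d' : F) :
  b != 0 -> d != 0 ->
  ((a' * d + a * d' + (c' * b + c * b')) * (b * d)
   - (a * d + c * b) * (b' * d + b * d')) / (b * d) ^+ 2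
  = (a' * b - a * b') / b ^+ 2 + (c' * d - c * d') / d ^+ 2.
Proof. by move=> b0 d0; field; rewrite b0 d0. Qed.

Lemma quotient_ruleM (F : fieldType) (a b c d a' b' c' d' : F) :
  b != 0 -> d != 0 ->
  ((a' * c + a * c') * (b * d) - (a * c) * (b' * d + b * d')) / (b * d) ^+ 2
  = (a' * b - a * b') / b ^+ 2 * (c / d)
    + (a / b) * ((c' * d - c * d') / d ^+ 2).
Proof. by move=> b0 d0; field; rewrite b0 d0. Qed.

Lemma dsD f g : ds (f + g) = ds f + ds g.
Proof.
have [Df0 Dg0] := (denom_neq0 f, denom_neq0 g).
rewrite (@dsE (f + g) (numer f * denom g + numer g * denom f)
  (denom f * denom g)) ?mulf_neq0 //; last first.
  by rewrite rmorphD !rmorphM /= -!denomP; ring.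
rewrite /ds !derivD !derivM !(rmorphB, rmorphD, rmorphM) /=.
by apply: quotient_ruleD; rewrite ratfun_eq0.
Qed.

Lemma dsM f g : ds (f * g) = ds f * g + f * ds g.
Proof.
have [Df0 Dg0] := (denom_neq0 f, denom_neq0 g).
rewrite (@dsE (f * g) (numer f * numer g)
  (denom f * denom g)) ?mulf_neq0 //; last first.
  by rewrite !rmorphM /= -!denomP; ring.
have fE : f = ratfun (numer f) / ratfun (denom f).
  by rewrite -denomP mulfK // ratfun_eq0.
have gE : g = ratfun (numer g) / ratfun (denom g).
  by rewrite -denomP mulfK // ratfun_eq0.
have -> : ds f * g + f * ds g = ds f * (ratfun (numer g) / ratfun (denom g))
    + (ratfun (numer f) / ratfun (denom f)) * ds g by rewrite -gE -fE.
rewrite [in RHS]/ds !derivM !(rmorphB, rmorphD, rmorphM) /=.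
by apply: quotient_ruleM; rewrite ratfun_eq0.
Qed.

Lemma ydyD f g : ydy (f + g) = ydy f + ydy g.
Proof. by rewrite /ydy dsD mulrDr. Qed.

Lemma ydyM f g : ydy (f * g) = ydy f * g + f * ydy g.
Proof. by rewrite /ydy dsM; ring. Qed.

Lemma ydy0 : ydy 0 = 0.
Proof. by apply: (addrI (ydy 0)); rewrite -ydyD !addr0. Qed.

Lemma ydyN f : ydy (- f) = - ydy f.
Proof. by apply: (addrI (ydy f)); rewrite -ydyD !subrr ydy0. Qed.

Lemma ydy1 : ydy 1 = 0.
Proof. by apply: (addrI (ydy 1));
rewrite -{3}[1]mulr1 ydyM mul1r mulr1 addr0. Qed.

Lemma ydy_sqrty : ydy sqrty = 2%:R^-1 * sqrty.
Proof.
rewrite /ydy (@dsE sqrty 'X 1) ?oner_eq0 ?rmorph1 ?mulr1 //.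
by rewrite derivX derivC mulr0 subr0 rmorph1 expr1n divr1 mulr1.
Qed.

Lemma nat_neq0_Qs n : (n.+1%:R : Qs) != 0.
Proof.
by rewrite -(rmorph_nat ratfun) ratfun_eq0 -polyC_natr polyC_eq0 pnatr_eq0.
Qed.

Lemma ydy_spow (z : int) : ydy (sqrty ^ z) = (z%:~R / 2%:R) * sqrty ^ z.
Proof.
have nat_case n : ydy (sqrty ^+ n) = (n%:R / 2%:R) * sqrty ^+ n.
  elim: n => [|n IHn]; first by rewrite expr0 ydy1 mul0r mul0r.
  by rewrite exprS ydyM ydy_sqrty IHn -[n.+1]addn1 natrD; ring.
case: z => n; first exact: nat_case.
have sn0 : sqrty ^+ n.+1 != 0 by rewrite expf_neq0 // sqrty_neq0.
apply: (mulfI sn0); rewrite NegzE -exprnN.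
(* Negative powers: differentiate s^(n+1) s^-(n+1) = 1. *)
have := ydyM (sqrty ^+ n.+1) (sqrty ^+ n.+1)^-1.
rewrite divff // ydy1 nat_case => /esym/eqP; rewrite addrC addr_eq0 => /eqP ->.
rewrite mulfK // [RHS]mulrCA divff // mulr1 mulrNz mulNr //.
Qed.

Definition ratK (c : rat) : Qs := ratfun c%:P.

Lemma ratK_is_zmod : zmod_morphism ratK.
Proof. by move=> a b; rewrite /ratK polyCB rmorphB. Qed.
Lemma ratK_is_monoid : monoid_morphism ratK.
Proof. by split=> [|a b]; rewrite /ratK ?rmorph1 // polyCM rmorphM. Qed.
HB.instance Definition _ :=
  GRing.isZmodMorphism.Build rat Qs ratK ratK_is_zmod.
HB.instance Definition _ :=
  GRing.isMonoidMorphism.Build rat Qs ratK ratK_is_monoid.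

Definition pcoefz (p : {poly rat}) (z : int) : rat :=
  if z is Posz n then p`_n else 0.

Lemma pcoefz_mulXn p m z : pcoefz (p * 'X^m) (z + m%:Z) = pcoefz p z.
Proof.
case: z => [n|n].
  by rewrite -PoszD /= coefMXn addnC ltnNge leq_addr addKn.
rewrite /=; case E: (Negz n + m%:Z) => [k|//] /=.
by rewrite coefMXn; case: ltnP => //; move: E; lia.
Qed.

(** Frees [ycoef] from the chosen fraction: the coefficients can be read off any presentation of f
    as P / s^M. With D = E X^m and E(0) nonzero, N X^M = P X^m E, and E is invertible as a power
    series. *)
Lemma ycoefE f P M : f * sqrty ^+ M = ratfun P ->
  forall k : int, ycoef f k = pcoefz P (2%:Z * k + M%:Z).
Proof.
move=> fM k; rewrite /ycoef; set D := denom f; set m := mup 0 D.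
have D0 : D != 0 by apply: denom_neq0.
have XmD : 'X^m %| D.
  by have := mup_geq 0 m D0; rewrite leqnn polyC0 subr0 => <-.
have DE : D = D %/ 'X^m * 'X^m by rewrite divpK.
set E := D %/ 'X^m in DE *.
have E00 : E`_0 != 0.
  rewrite -horner_coef0; have := mup_leq 0 m D0; rewrite leqnn polyC0 subr0.
  move/esym/negP => ndvd; apply/negP => E0; apply: ndvd.
  by rewrite DE exprS dvdp_mul // -['X]subr0 -polyC0 dvdp_XsubCl.
have NE : numer f * 'X^M = (P * 'X^m) * E.
  apply: ratfun_inj; rewrite !rmorphM !rmorphXn /= -denomP.
  rewrite -/sqrty -fM -/D {1}DE rmorphM rmorphXn /= -/sqrty.
  by rewrite mulrAC (mulrC (ratfun E)) mulrA.
rewrite -(pcoefz_mulXn P m).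
(* The expansion of N / E; the series variable [psq] stands for s here. *)
pose w : pser rat := pps (numer f) * (ps_inv (pps E) : pser rat).
have wE i : (psq ^+ M * w) i = (P * 'X^m)`_i.
  rewrite /w mulrA -rmorphXn -rmorphM /= [_ * numer f]mulrC NE rmorphM /=.
  by rewrite -mulrA ps_mulV ?mulr1.
have wcoef i : w i = (P * 'X^m)`_(i + M).
  by rewrite -wE ps_mulqX leq_addl addnK.
have wsmall i : (i < M)%N -> (P * 'X^m)`_i = 0.
  by move=> ltiM; rewrite -wE ps_mulqX leqNgt ltiM.
rewrite addrAC; case: (2%:Z * k + m%:Z) => [n|n].
  by rewrite -[LHS]/(w n) wcoef.
(* For 2k + m < 0 [ycoef] takes its default value 0; on the other side the index is below M, where
   [P * 'X^m] has no coefficients. *)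
case E1: (Negz n + M%:Z) => [i|//] /=.
by rewrite wsmall //; move: E1; lia.
Qed.

(** * Laurent polynomials and SL_2 characters *)

Definition laurent f := exists M P, f * sqrty ^+ M = ratfun P.

Lemma laurent_lift f M P m : f * sqrty ^+ M = ratfun P ->
  f * sqrty ^+ (M + m) = ratfun (P * 'X^m).
Proof. by move=> e; rewrite exprD mulrA e rmorphM rmorphXn. Qed.

Lemma laurentD f g : laurent f -> laurent g ->
  laurent (f + g) /\ forall k, ycoef (f + g) k = ycoef f k + ycoef g k.
Proof.
move=> [M [P e]] [M' [P' e']].
have el := laurent_lift M' e; have el' := laurent_lift M e'.
rewrite addnC in el'.
have es : (f + g) * sqrty ^+ (M + M') = ratfun (P * 'X^M' + P' * 'X^M).
  by rewrite mulrDl el el' rmorphD.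
split=> [|k]; first by exists (M + M')%N, (P * 'X^M' + P' * 'X^M).
rewrite (ycoefE es) (ycoefE el) (ycoefE el') /pcoefz.
by case: (_ + _) => n; rewrite ?coefD ?addr0.
Qed.

Lemma laurentZ c f : laurent f ->
  laurent (ratK c * f) /\ forall k, ycoef (ratK c * f) k = c * ycoef f k.
Proof.
move=> [M [P e]].
have ec : (ratK c * f) * sqrty ^+ M = ratfun (c *: P).
  by rewrite -mulrA e -mul_polyC rmorphM.
split=> [|k]; first by exists M, (c *: P).
rewrite (ycoefE ec) (ycoefE e) /pcoefz.
by case: (_ + _) => n; rewrite ?coefZ ?mulr0.
Qed.

Lemma laurent0 : laurent 0 /\ forall k, ycoef 0 k = 0.
Proof.
have e : 0 * sqrty ^+ 0 = ratfun 0 by rewrite mul0r rmorph0.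
split=> [|k]; first by exists 0%N, 0.
by rewrite (ycoefE e) /pcoefz; case: (_ + _) => n; rewrite ?coef0.
Qed.

Lemma laurent_spow (z : int) : laurent (sqrty ^ z) /\
  forall k, ycoef (sqrty ^ z) k = (z == 2%:Z * k)%:R.
Proof.
have e : sqrty ^ z * sqrty ^+ `|z|%N = ratfun 'X^(absz (z + `|z|%N%:Z)).
  rewrite rmorphXn /= -/sqrty !exprnP -expfzDr ?sqrty_neq0 //.
  by congr (_ ^ _); lia.
split=> [|k]; first by exists `|z|%N, ('X^(absz (z + `|z|%N%:Z))).
rewrite (ycoefE e) /pcoefz; case E : (2%:Z * k + _) => [n|n].
  by rewrite coefXn; congr (_%:R); apply/eqP/eqP; lia.
by case: eqP => // zk; move: E; rewrite -zk; lia.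
Qed.

Lemma laurent_sum (I : Type) (r : seq I) (f : I -> Qs) :
  (forall i, laurent (f i)) -> laurent (\sum_(i <- r) f i) /\
  forall k, ycoef (\sum_(i <- r) f i) k = \sum_(i <- r) ycoef (f i) k.
Proof.
move=> lf; elim: r => [|i r [IHl IHc]].
  rewrite big_nil; split=> [|k]; first exact: laurent0.1.
  by rewrite big_nil laurent0.2.
have [lD cD] := laurentD (lf i) IHl.
by rewrite big_cons; split=> // k; rewrite big_cons cD IHc.
Qed.

Lemma spowD (a b : int) : sqrty ^ (a + b) = sqrty ^ a * sqrty ^ b.
Proof. by rewrite expfzDr ?sqrty_neq0. Qed.

(* The character of the irreducible representation of SL_2 of dimension r + 1:
   symmetric unimodal sequences are nonnegative combinations of these. *)
Definition slchar (r : nat) : Qs :=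
  \sum_(i < r.+1) sqrty ^ (r%:Z - (2 * i)%N%:Z).

Lemma slchar0 : slchar 0 = 1.
Proof. by rewrite /slchar big_ord1. Qed.

Lemma slchar1 : slchar 1 = sqrty + sqrty^-1.
Proof. by rewrite /slchar big_ord_recl big_ord1 /= expr1z exprN1. Qed.

Lemma laurent_slchar r : laurent (slchar r).
Proof. by apply: (laurent_sum _ _).1 => i; apply: (laurent_spow _).1. Qed.

Lemma ycoef_slchar r k : ycoef (slchar (2 * r)) k = (`|k| <= r)%N%:R.
Proof.
rewrite /slchar (laurent_sum _ _).2; last by move=> i;
  apply: (laurent_spow _).1.
under eq_bigr do rewrite (laurent_spow _).2.
case: leqP => [lekr|ltrk]; last first.
  by rewrite big1 // => i _; case: eqP => // e; move: (ltn_ord i); lia.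
have lt_i0 : (absz (r%:Z - k) < (2 * r).+1)%N by lia.
rewrite (bigD1 (Ordinal lt_i0)) //= big1.
  by rewrite addr0; case: eqP => //; lia.
move=> i; rewrite -val_eqE /= => /eqP nei; case: eqP => // e.
by case: nei; lia.
Qed.

Lemma sqrtyBV_neq0 : sqrty - sqrty^-1 != 0.
Proof.
rewrite subr_eq0; apply/eqP => e.
have : sqrty ^+ 2 == 1 by rewrite expr2 {1}e mulVf ?sqrty_neq0.
rewrite -subr_eq0 -rmorphXn -(rmorph1 ratfun) -rmorphB ratfun_eq0.
by rewrite -size_poly_eq0 size_XnsubC.
Qed.

(** Weyl's character formula for SL_2. *)
Lemma slchar_telescope r :
  (sqrty - sqrty^-1) * slchar r = sqrty ^ (r.+1%:Z) - sqrty ^ (- r.+1%:Z).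
Proof.
pose u i := - sqrty ^ (r.+1%:Z - (2 * i)%N%:Z).
rewrite mulr_sumr -(big_mkord xpredT
  (fun i => (sqrty - sqrty^-1) * sqrty ^ (r%:Z - (2 * i)%N%:Z))).
rewrite (eq_bigr (fun i => u i.+1 - u i)) ?telescope_sumr //.
  rewrite /u opprK addrC muln0 subr0; congr (_ - _ ^ _).
  by rewrite mul2n -addnn PoszD opprD addrA subrr sub0r.
move=> i _; rewrite /u opprK
  [RHS]addrC mulrBl -exprN1 -{1}[sqrty]expr1z -!spowD.
by congr (_ ^ _ - _ ^ _); lia.
Qed.

(** The Clebsch-Gordan rule. After multiplication by s - 1/s, Weyl's formula turns both sides into
    the same powers of s, the negative ones in reverse order; t <= r keeps the subtraction in the
    index exact. *)
Lemma slcharM r t : (t <= r)%N ->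
  slchar r * slchar t = \sum_(i < t.+1) slchar (r + t - 2 * i).
Proof.
move=> letr; apply: (mulfI sqrtyBV_neq0).
rewrite mulrA slchar_telescope mulrBl [RHS]mulr_sumr.
under [RHS]eq_bigr do rewrite slchar_telescope.
rewrite sumrB {1 2}/slchar !mulr_sumr; congr (_ - _).
  apply: eq_bigr => i _; rewrite -spowD; congr (_ ^ _).
  by move: (ltn_ord i); lia.
rewrite (reindex_inj rev_ord_inj); apply: eq_bigr => i _ /=.
by rewrite -spowD; congr (_ ^ _); move: (ltn_ord i); lia.
Qed.

(** The cone spanned by the characters of the parity of r up to r. Stated inductively, it has its
    closure properties proved one summand at a time; r is only an upper bound for the top
    character. *)
Inductive charpos (r : nat) : Qs -> Prop :=
| charpos0 : charpos r 0
| charpos_add i c f : 0 <= c -> (i <= r)%N -> odd i = odd r ->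
    charpos r f -> charpos r (ratK c * slchar i + f).

Lemma charposD r f g : charpos r f -> charpos r g -> charpos r (f + g).
Proof.
move=> pf pg; elim: pf => [|i c f' c0 leir oir _ IHf]; first by rewrite add0r.
by rewrite -addrA; apply: charpos_add.
Qed.

Lemma charpos_sum r (I : Type) (s : seq I) (f : I -> Qs) :
  (forall i, charpos r (f i)) -> charpos r (\sum_(i <- s) f i).
Proof.
move=> pf; elim: s => [|i s IHs]; rewrite ?big_nil ?big_cons.
  exact: charpos0.
exact: charposD.
Qed.

Lemma charposZ r c f : 0 <= c -> charpos r f -> charpos r (ratK c * f).
Proof.
move=> c0; elim=> [|i d f' d0 leir oir _ IHf].
  by rewrite mulr0; apply: charpos0.
by rewrite mulrDr mulrA -rmorphM; apply: charpos_add => //; apply: mulr_ge0.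
Qed.

Lemma charpos_le r t f : (r <= t)%N -> odd r = odd t ->
  charpos r f -> charpos t f.
Proof.
move=> lert ort; elim=> [|i c f' c0 leir oir _ IHf]; first exact: charpos0.
by apply: charpos_add; rewrite ?oir // (leq_trans leir).
Qed.

Lemma charpos_slchar r i : (i <= r)%N -> odd i = odd r -> charpos r (slchar i).
Proof.
move=> leir oir; rewrite -[slchar i]mul1r -(rmorph1 ratK) -[_ * _]addr0.
by apply: charpos_add => //; apply: charpos0.
Qed.

Lemma charpos_slcharM r t : charpos (r + t) (slchar r * slchar t).
Proof.
wlog letr : r t / (t <= r)%N => [IH|].
  case: (leqP t r) => [/IH //|/ltnW /IH]; by rewrite addnC mulrC.
rewrite slcharM //; apply: charpos_sum => i; apply: charpos_slchar.
  exact: leq_subr.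
by rewrite oddB ?oddM ?addbF //; move: (ltn_ord i); lia.
Qed.

Lemma charposM r t f g : charpos r f -> charpos t g -> charpos (r + t) (f * g).
Proof.
move=> pf pg; elim: pf => [|i c f' c0 leir oir _ IHf].
  by rewrite mul0r; apply: charpos0.
rewrite mulrDl; apply: charposD => //; rewrite -mulrA; apply: charposZ => //.
elim: pg => [|j d g' d0 lejt ojt _ IHg]; first by rewrite mulr0;
  apply: charpos0.
rewrite mulrDr; apply: charposD => //; rewrite mulrCA; apply: charposZ => //.
apply: charpos_le (charpos_slcharM i j); first exact: leq_add.
by rewrite !oddD oir ojt.
Qed.

(** The model of a strictly unimodal sequence: for even r its coefficients drop by exactly 1 at each
    step away from the centre, see [ycoef_staircase]. *)
Definition staircase (r : nat) : Qs := \sum_(i < r./2.+1) slchar (r - 2 * i).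

Lemma staircaseSS r : staircase r.+2 = slchar r.+2 + staircase r.
Proof.
rewrite /staircase big_ord_recl /= muln0 subn0; congr (_ + _).
by apply: eq_bigr => i _; congr slchar; rewrite /bump; lia.
Qed.

Lemma charpos_staircase r : charpos r (staircase r).
Proof.
apply: charpos_sum => i; apply: charpos_slchar; first exact: leq_subr.
rewrite oddB ?oddM ?addbF //; move: (ltn_ord i); lia.
Qed.

Lemma slcharM_top r t : charpos (r + t) (slchar r * slchar t - slchar (r + t)).
Proof.
wlog letr : r t / (t <= r)%N => [IH|].
  case: (leqP t r) => [/IH //|/ltnW /IH]; by rewrite addnC mulrC.
rewrite slcharM // big_ord_recl muln0 subn0 addrAC subrr add0r.
apply: charpos_sum => i; apply: charpos_slchar; first exact: leq_subr.
by rewrite oddB ?oddM ?addbF //; move: (ltn_ord i); rewrite lift0; lia.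
Qed.

Lemma charpos_staircase_sub r : charpos r (staircase r - slchar r).
Proof.
rewrite /staircase big_ord_recl muln0 subn0 addrAC subrr add0r.
apply: charpos_sum => i; apply: charpos_slchar; first exact: leq_subr.
by rewrite oddB ?oddM ?addbF //; move: (ltn_ord i); rewrite lift0; lia.
Qed.

Lemma nat_ind2 (P : nat -> Prop) :
  P 0%N -> P 1%N -> (forall n, P n -> P n.+2) -> forall n, P n.
Proof.
move=> P0 P1 PS n; suff: P n /\ P n.+1 by case.
by elim: n => [//|n [Pn Pn1]]; split=> //; apply: PS.
Qed.

(** By induction on r in steps of two: the character gained on the right, of index r + t + 2, is the
    top character of [slchar r.+2 * slchar t]. *)
Lemma staircaseM r t :
  charpos (r + t) (staircase r * staircase t - staircase (r + t)).
Proof.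
have stepE (a b c d e : Qs) : (a + b) * c - (d + e) = (a * c - d) + (b * c - e).
  by rewrite mulrDl opprD addrACA.
have st0 : staircase 0 = 1 by rewrite /staircase big_ord1 slchar0.
have st1 : staircase 1 = slchar 1 by rewrite /staircase big_ord1.
elim/nat_ind2: r => [||r IHr].
- by rewrite st0 mul1r subrr; apply: charpos0.
- rewrite st1 mulrC; elim/nat_ind2: t => [||t IHt].
  + by rewrite st0 st1 mul1r subrr; apply: charpos0.
  + rewrite st1 staircaseSS st0 slcharM // !big_ord_recl big_ord0 /= addr0.
    by rewrite slchar0 subrr; apply: charpos0.
  + rewrite !addnS !staircaseSS stepE; apply: charposD.
      by have := slcharM_top t.+2 1; rewrite addnC !addnS.
    by apply: charpos_le IHt; lia.
rewrite !addSn !staircaseSS stepE; apply: charposD; last first.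
  by apply: charpos_le IHr; lia.
(* Only the top character of [staircase t] is needed to produce the new one; the others contribute a
   positive remainder. *)
rewrite -(subrK (slchar t) (staircase t)) mulrDr -addrA.
rewrite -!addSn; apply: charposD; last exact: slcharM_top.
by apply: charposM; [apply: charpos_slchar | apply: charpos_staircase_sub].
Qed.

(* All the characters of the parity of r up to r occur in f. *)
Definition strictchar r f :=
  exists2 c, 0 < c & charpos r (f - ratK c * staircase r).

Lemma strictchar_pos r f : strictchar r f -> charpos r f.
Proof.
move=> [c c0 pf]; rewrite -(subrK (ratK c * staircase r) f).
by apply: charposD => //; apply: charposZ; rewrite ?ltW //;
  apply: charpos_staircase.
Qed.

Lemma strictcharD r f g : strictchar r f -> charpos r g -> strictchar r (f + g).
Proof.
by move=> [c c0 pf] pg; exists c => //; rewrite addrAC; apply: charposD.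
Qed.

Lemma strictcharM r t f g :
  strictchar r f -> strictchar t g -> strictchar (r + t) (f * g).
Proof.
move=> [c c0 pf] sg; have pg := strictchar_pos sg; case: sg => d d0 pg'.
exists (c * d); first exact: mulr_gt0.
set Sr := staircase r in pf; set St := staircase t in pg'.
(* Replacing first f and then g by its multiple of a staircase costs only positive terms; the last
   summand is [staircaseM]. *)
have -> : f * g - ratK (c * d) * staircase (r + t) =
    (f - ratK c * Sr) * g + ratK c * (Sr * (g - ratK d * St))
    + ratK (c * d) * (Sr * St - staircase (r + t)).
  have idE (R : comNzRingType) (a b u v m n w : R) : a * b - u * v * w =
    (a - u * m) * b + u * (m * (b - v * n)) + u * v * (m * n - w) by ring.
  by rewrite !rmorphM; apply: idE.
have pS := charpos_staircase r.
apply: charposD; first apply: charposD.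
- exact: charposM.
- by apply: charposZ; [rewrite ltW | apply: charposM].
- by apply: charposZ; [rewrite ltW // mulr_gt0 | apply: staircaseM].
Qed.

(** Only the parity is remembered, so that summands with different top characters can be added. Zero
    contains no staircase and is a case of its own in [strict_class]. *)
Definition unimodal_class (p : bool) f := exists2 r, odd r = p & charpos r f.
Definition strict_class (p : bool) f :=
  f = 0 \/ exists2 r, odd r = p & strictchar r f.

Lemma unimodal_class0 p : unimodal_class p 0.
Proof. by exists p; [case: p | apply: charpos0]. Qed.

Lemma unimodal_classD p f g :
  unimodal_class p f -> unimodal_class p g -> unimodal_class p (f + g).
Proof.
move=> [r orp pf] [t otp pg]; exists (maxn r t).
  by rewrite /maxn; case: ifP.
apply: charposD; [apply: charpos_le pf | apply: charpos_le pg].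
- exact: leq_maxl.
- by rewrite /maxn; case: ifP => _; rewrite orp ?otp.
- exact: leq_maxr.
- by rewrite /maxn; case: ifP => _; rewrite otp ?orp.
Qed.

Lemma unimodal_classZ p c f : 0 <= c -> unimodal_class p f ->
  unimodal_class p (ratK c * f).
Proof. by move=> c0 [r orp pf]; exists r => //; apply: charposZ. Qed.

Lemma unimodal_classM p p' f g :
  unimodal_class p f -> unimodal_class p' g -> unimodal_class (p (+) p') (f *
    g).
Proof.
move=> [r orp pf] [t otp pg]; exists (r + t)%N; first by rewrite oddD orp otp.
exact: charposM.
Qed.

Lemma unimodal_class_slchar r : unimodal_class (odd r) (slchar r).
Proof. by exists r => //; apply: charpos_slchar. Qed.

Lemma unimodal_class_ratK c : 0 <= c -> unimodal_class false (ratK c).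
Proof.
move=> c0; rewrite -[ratK c]mulr1 -slchar0; apply: unimodal_classZ => //.
exact: (unimodal_class_slchar 0).
Qed.

(** The summand with the larger bound supplies the staircase; the other one need only be
    positive. *)
Lemma strict_classD p f g :
  strict_class p f -> strict_class p g -> strict_class p (f + g).
Proof.
move=> [->|[r orp sf]]; first by rewrite add0r.
move=> [->|[t otp sg]]; first by rewrite addr0; right; exists r.
wlog lert : f g r t orp otp sf sg / (t <= r)%N => [IH|].
  by case: (leqP t r) => [/IH|/ltnW /IH]; [exact | rewrite addrC; exact].
right; exists r => //; apply: strictcharD => //.
by apply: charpos_le (strictchar_pos sg); rewrite ?orp.
Qed.

Lemma strict_classM p p' f g :
  strict_class p f -> strict_class p' g -> strict_class (p (+) p') (f * g).
Proof.
move=> [->|[r orp sf]]; first by rewrite mul0r; left.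
move=> [->|[t otp sg]]; first by rewrite mulr0; left.
right; exists (r + t)%N; first by rewrite oddD orp otp.
exact: strictcharM.
Qed.

Lemma strict_class_ratK c : 0 <= c -> strict_class false (ratK c).
Proof.
rewrite le_eqVlt => /predU1P [<-|c0]; first by left; rewrite rmorph0.
right; exists 0%N => //; exists c => //.
by rewrite /staircase big_ord1 slchar0 mulr1 subrr; apply: charpos0.
Qed.

(** * From combinations of characters to symmetric unimodal sequences *)

Lemma laurent_charpos r f : charpos r f -> laurent f.
Proof.
elim=> [|i c g c0 leir oir _ IHg]; first exact: laurent0.1.
exact: (laurentD (laurentZ c (laurent_slchar i)).1 IHg).1.
Qed.

Lemma ycoef_charpos_add i c f k : laurent f ->
  ycoef (ratK c * slchar i + f) k = c * ycoef (slchar i) k + ycoef f k.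
Proof.
move=> lf; have [lc cE] := laurentZ c (laurent_slchar i).
by rewrite (laurentD lc lf).2 cE.
Qed.

Section CharposCoefficients.
Variables (r : nat) (f : Qs).
Hypothesis pf : charpos (2 * r) f.

Lemma charpos_sym k : ycoef f k = ycoef f (- k).
Proof.
elim: pf => [|i c g c0 leir oir pg IHg]; first by rewrite !laurent0.2.
rewrite !ycoef_charpos_add ?IHg; try exact: laurent_charpos pg.
have -> : i = (2 * i./2)%N by rewrite oddM /= in oir; lia.
by rewrite !ycoef_slchar abszN.
Qed.

Lemma charpos_decr (n : nat) : ycoef f n.+1 <= ycoef f n.
Proof.
elim: pf => [|i c g c0 leir oir pg IHg]; first by rewrite !laurent0.2.
rewrite !ycoef_charpos_add; try exact: laurent_charpos pg.
have -> : i = (2 * i./2)%N by rewrite oddM /= in oir; lia.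
rewrite !ycoef_slchar lerD // ler_wpM2l // ler_nat /=.
by case: (ltnP n) => // /ltnW ->.
Qed.

Lemma charpos_supp (n : nat) : (r < n)%N -> ycoef f n = 0.
Proof.
move=> ltrn; elim: pf => [|i c g c0 leir oir pg IHg];
  first by rewrite laurent0.2.
rewrite ycoef_charpos_add ?IHg ?addr0; last exact: laurent_charpos pg.
have e : i = (2 * i./2)%N by rewrite oddM /= in oir; lia.
rewrite e ycoef_slchar /= leqNgt (leq_trans _ ltrn) ?mulr0 //.
by rewrite ltnS; lia.
Qed.

End CharposCoefficients.

Lemma ycoef_staircase r k : ycoef (staircase (2 * r)) k = (r.+1 - `|k|)%N%:R.
Proof.
elim: r => [|r IHr].
  rewrite /staircase big_ord1 (ycoef_slchar 0) leqn0.
  by case: (absz k).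
rewrite mulnS staircaseSS.
have ls : laurent (staircase (2 * r)) by apply: laurent_charpos
  (charpos_staircase _).
rewrite (laurentD (laurent_slchar _) ls).2 IHr -[(2 * r).+2]/(2
  + 2 * r)%N -mulnS.
by rewrite ycoef_slchar -natrD; congr (_%:R); case: leqP; lia.
Qed.

(** The staircase part drops strictly and the rest weakly. At n = r the drop is from the last
    nonzero coefficient to zero. *)
Lemma strictchar_decr r f (n : nat) : strictchar (2 * r) f -> (n <= r)%N ->
  ycoef f n.+1 < ycoef f n.
Proof.
move=> [c c0 pf] lenr.
have lf := laurent_charpos pf.
have ls : laurent (staircase (2 * r)) by apply: laurent_charpos
  (charpos_staircase _).
have [lc cE] := laurentZ c ls.
rewrite -(subrK (ratK c * staircase (2 * r)) f).
rewrite !(laurentD lf lc).2 !cE !ycoef_staircase /= ler_ltD ?(charpos_decr pf)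
  //.
by rewrite ltr_pM2l // ltr_nat subSS ltn_subLR // subnKC // ltnW.
Qed.

Lemma symmetric_unimodal_seq (a : int -> rat) (r : nat) :
  (forall k, a k = a (- k)) -> (forall n : nat, a n.+1 <= a n) ->
  (forall n : nat, (r < n)%N -> a n = 0) ->
  [/\ finitely_supported a, symmetric_seq a & unimodal a].
Proof.
move=> sym decr supp; split=> //.
  exists (- r%:Z), r%:Z => k; apply: contraNT => kr; apply/eqP.
  case: (leP 0 k) => k0; last rewrite sym.
    have -> : k = `|k|%N by lia.
    by apply: supp; lia.
  have -> : - k = `|k|%N by lia.
  by apply: supp; lia.
have mono (m n : nat) : (m <= n)%N -> a n <= a m.
  move/subnKC <-; elim: (n - m)%N => [|i IHi]; first by rewrite addn0.
  by rewrite addnS (le_trans (decr _)).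
exists 0 => i j _ _ ltij; split=> [lej0|le0i].
  rewrite (sym i) (sym j).
  have -> : - i = `|i|%N by lia.
  have -> : - j = `|j|%N by lia.
  by apply: mono; lia.
have -> : i = `|i|%N by lia.
have -> : j = `|j|%N by lia.
by apply: mono; lia.
Qed.

Lemma symmetric_strictly_unimodal_seq (a : int -> rat) (r : nat) :
  (forall k, a k = a (- k)) -> (forall n : nat, (n <= r)%N -> a n.+1 < a n) ->
  (forall n : nat, (r < n)%N -> a n = 0) ->
  [/\ finitely_supported a, symmetric_seq a & strictly_unimodal a].
Proof.
move=> sym decr supp.
have [fs _ _] : [/\ finitely_supported a, symmetric_seq a & unimodal a].
  apply: (symmetric_unimodal_seq (r := r)) => // n.
  by case: (leqP n r) => [/decr /ltW //|ltrn]; rewrite !supp // ltnW.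
have supp_int i : a i != 0 -> - r%:Z <= i <= r%:Z.
  apply: contraNT => kr; apply/eqP.
  case: (leP 0 i) => k0; last rewrite sym.
    have -> : i = `|i|%N by lia.
    by apply: supp; lia.
  have -> : - i = `|i|%N by lia.
  by apply: supp; lia.
split=> //.
have mono (m n : nat) : (m < n)%N -> (n <= r)%N -> a n < a m.
  move/subnKC <-; elim: (n - m.+1)%N => [|i IHi] ler.
    by rewrite addn0 in ler *; rewrite decr // ltnW.
  rewrite addnS in ler *; apply: lt_trans (IHi _); last exact: ltnW.
  by rewrite decr // ltnW.
exists 0 => i j hi hj ltij.
(* The interval from -r to r contains the support, so indices in the hull lie in the range where the
   decrease is strict. *)
have {}hi := hi _ _ supp_int; have {}hj := hj _ _ supp_int.
split=> [lej0|le0i].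
  rewrite (sym i) (sym j).
  have -> : - i = `|i|%N by lia.
  have -> : - j = `|j|%N by lia.
  by apply: mono; lia.
have -> : i = `|i|%N by lia.
have -> : j = `|j|%N by lia.
by apply: mono; lia.
Qed.

Lemma unimodal_class_seq f : unimodal_class false f ->
  [/\ finitely_supported (ycoef f), symmetric_seq (ycoef f)
    & unimodal (ycoef f)].
Proof.
move=> [r or pf]; have er : r = (2 * r./2)%N by lia.
rewrite er in pf; apply: (symmetric_unimodal_seq (r := r./2)).
- exact: charpos_sym pf.
- exact: charpos_decr pf.
- exact: charpos_supp pf.
Qed.

Lemma strict_class_seq f : strict_class false f ->
  [/\ finitely_supported (ycoef f), symmetric_seq (ycoef f)
    & strictly_unimodal (ycoef f)].
Proof.
move=> [->|[r or sf]].
  split.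
  - by exists 0, 0 => k; rewrite laurent0.2 eqxx.
  - by move=> k; rewrite !laurent0.2.
  (* For the zero sequence the hull is empty: even the empty interval from 1 to 0 contains all
     nonzero terms. *)
  - exists 0 => i j hi; suff: (1 <= i <= 0) by lia.
    by apply: hi => k; rewrite laurent0.2 eqxx.
have er : r = (2 * r./2)%N by lia.
rewrite er in sf; apply: (symmetric_strictly_unimodal_seq (r := r./2)).
- exact: charpos_sym (strictchar_pos sf).
- by move=> n; apply: strictchar_decr.
- exact: charpos_supp (strictchar_pos sf).
Qed.

(** * The Jacobi triple product *)

Definition trinum (n : nat) : nat := 'C(n.+1, 2).

Lemma trinumS n : trinum n.+1 = (trinum n + n.+1)%N.
Proof. by rewrite /trinum binS bin1. Qed.

Lemma trinum_ge n : (n <= trinum n)%N.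
Proof. by case: n => // n; rewrite trinumS leq_addl. Qed.

Section JacobiTripleProduct.
Variable F : fieldType.

Definition ipochn m : pser F := \prod_(i < m) geo F i.+1.

Lemma ipochnS m : ipochn m = (1 - psq ^+ m.+1) * ipochn m.+1.
Proof.
by rewrite /ipochn big_ord_recr /= mulrCA geoP // mulr1.
Qed.

Lemma pochnS m : pochn F m.+1 = pochn F m * (1 - psq ^+ m.+1).
Proof. by rewrite /pochn big_ord_recr. Qed.

Lemma pochn_ipochn m : pochn F m * ipochn m = 1.
Proof. by rewrite -big_split big1 //= => i _; rewrite geoP. Qed.

Lemma ipochn_ipoch N m : (N <= m)%N -> eqm N (ipochn m) ipoch.
Proof.
move=> leNm; apply: eqm_inv (pochn_ipochn m) (poch_ipoch F) _.
by apply/eqm_sym/poch_pochn.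
Qed.

(* The Gaussian binomial coefficient of 2 (n + e) + 1 over e, times
   q ^ (n (n + 1) / 2). *)
Definition jtp_coef (e n : nat) : pser F :=
  pochn F (2 * (n + e)).+1 * psq ^+ trinum n * ipochn e * ipochn (e + 2 * n).+1.

(** The core of [jtp_coef_rec], with u = q^e and v = q^(e+2n+1). *)
Lemma jtp_identity (R : comPzRingType) (u v q : R) :
  (1 - u * v * q) * (1 - u * v * q * q) =
  (1 + u * v * q) * ((1 - u * q) * (1 - v * q))
  + (u * q * ((1 - v) * (1 - v * q)) + v * q * ((1 - u) * (1 - u * q))).
Proof. by ring. Qed.

(** The neighbours n - 1 and n + 1 for the same N = e + n. At n = 0 the left neighbour folds back to
    n = 0, because s^(2n+1) + s^-(2n+1) takes the same value at n = -1 and n = 0; at e = 0 there is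
    no right neighbour. *)
Definition jtp_prev e n : pser F :=
  if n is n'.+1 then jtp_coef e.+1 n' else jtp_coef e 0.
Definition jtp_next e n : pser F :=
  if e is e'.+1 then jtp_coef e' n.+1 else 0.

Lemma jtp_coef_rec e n :
  jtp_coef e.+1 n = (1 + psq ^+ (2 * (n + e)).+2) * jtp_coef e n
    + psq ^+ (n + e).+1 * (jtp_prev e n + jtp_next e n).
Proof.
pose u : pser F := psq ^+ e; pose v : pser F := psq ^+ (e + 2 * n).+1.
(* A common factor of all four terms; what is left of each is a polynomial in u, v and q. *)
pose W := pochn F (2 * (n + e)).+1 * psq ^+ trinum n * ipochn e.+1
  * ipochn (e + 2 * n).+2.
have uq : psq ^+ e.+1 = u * psq by rewrite exprSr.
have vq : psq ^+ (e + 2 * n).+2 = v * psq by rewrite exprSr.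
have uvq : psq ^+ (2 * (n + e)).+2 = u * v * psq.
  by rewrite -exprD -exprSr; congr (_ ^+ _); lia.
have lhsE : jtp_coef e.+1 n = W * ((1 - u * v * psq) * (1 - u * v * psq * psq)).
  rewrite /jtp_coef (_ : (2 * (n + e.+1)).+1 = (2 * (n + e)).+3); last by lia.
  by rewrite 2!pochnS (exprSr _ (2 * (n + e)).+2) uvq addSn /W; ring.
have midE : jtp_coef e n = W * ((1 - u * psq) * (1 - v * psq)).
  by rewrite /jtp_coef (ipochnS e) (ipochnS (e + 2 * n).+1) uq vq /W; ring.
have prevE : psq ^+ (n + e).+1 * jtp_prev e n =
    W * (u * psq * ((1 - v) * (1 - v * psq))).
  rewrite /jtp_prev /W -uq -vq /v; case: (n) => [|m].
    by rewrite /jtp_coef muln0 addn0 (ipochnS e) (ipochnS e.+1) add0n; ring.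
  rewrite /jtp_coef (_ : m + e.+1 = m.+1 + e)%N; last by lia.
  rewrite (ipochnS (e.+1 + _).+1) (ipochnS (e.+1 + _).+2).
  rewrite (_ : (e.+1 + 2 * m).+2 = (e + 2 * m.+1).+1); last by lia.
  have -> : psq ^+ (m.+1 + e).+1 = psq ^+ e.+1 * psq ^+ m.+1 :> pser F.
    by rewrite -exprD; congr (_ ^+ _); lia.
  by rewrite trinumS (exprD _ (trinum m)); ring.
have nextE : psq ^+ (n + e).+1 * jtp_next e n =
    W * (v * psq * ((1 - u) * (1 - u * psq))).
  rewrite /jtp_next -vq -uq /W /u; case: (e) => [|e'].
    by rewrite expr0 subrr mul0r !mulr0.
  rewrite /jtp_coef (_ : n.+1 + e' = n + e'.+1)%N; last by lia.
  rewrite (ipochnS e') (ipochnS e'.+1).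
  rewrite (_ : (e' + 2 * n.+1).+1 = (e'.+1 + 2 * n).+2); last by lia.
  have -> : psq ^+ (e'.+1 + 2 * n).+2 =
      psq ^+ (n + e'.+1).+1 * psq ^+ n.+1 :> pser F.
    by rewrite -exprD; congr (_ ^+ _); lia.
  by rewrite trinumS (exprD _ (trinum n)); ring.
by rewrite (mulrDr (psq ^+ (n
  + e).+1)) prevE nextE lhsE midE uvq jtp_identity; ring.
Qed.

Lemma jtp_coef_top N : jtp_coef 0 N = psq ^+ trinum N.
Proof.
rewrite /jtp_coef addn0 add0n /ipochn big_ord0 mulr1 mulrAC -/(ipochn _).
by rewrite pochn_ipochn mul1r.
Qed.

(** As e grows the Gaussian binomial tends to 1 / (q; q)_oo. All finite products involved have at
    least e factors, so the error starts beyond q^e. *)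
Lemma jtp_coef_eqm e n :
  eqm (e + trinum n) (poch * jtp_coef e n) (psq ^+ trinum n).
Proof.
have -> : poch * jtp_coef e n = psq ^+ trinum n *
    (poch * pochn F (2 * (n + e)).+1 * (ipochn e * ipochn (e + 2 * n).+1)).
  by rewrite /jtp_coef; ring.
rewrite -[X in eqm _ _ X]mulr1; apply: eqm_mulqX.
have -> : 1 = (poch * poch) * (ipoch * ipoch) :> pser F.
  by rewrite mulrACA poch_ipoch mulr1.
apply: eqmM; apply: eqmM => //.
- by apply/eqm_sym/poch_pochn; lia.
- exact: ipochn_ipoch.
- by apply: ipochn_ipoch; lia.
Qed.

Variable s : F.
Hypothesis s0 : s != 0.

Definition thchar (n : nat) : F := s ^+ (2 * n).+1 + s^-1 ^+ (2 * n).+1.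

Lemma thcharM n : (s ^+ 2 + s^-1 ^+ 2) * thchar n =
  thchar n.+1 + (if n is n'.+1 then thchar n' else thchar 0).
Proof.
rewrite /thchar; case: n => [|n]; first by rewrite muln0 !muln1; field.
have powE (x : F) k : x ^+ (2 * k.+1).+1 = x ^+ 2 * x ^+ (2 * k).+1.
  by rewrite -exprD; congr (_ ^+ _); lia.
rewrite !(powE s) !(powE s^-1).
by move: (s ^+ (2 * n).+1) (s^-1 ^+ (2 * n).+1) => a b; field.
Qed.

(** The N-th partial product of theta_1, without q^(1/8) and (q; q)_oo. *)
Definition jtp_lhs N : pser F := psC (s^-1 + s) *
  (qprod (- s ^+ 2) N * qprod (- s^-1 ^+ 2) N).

Lemma jtp_lhsS N : jtp_lhs N.+1 = jtp_lhs N *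
  (1 + psq ^+ (2 * N).+2 + psq ^+ N.+1 * psC (s ^+ 2 + s^-1 ^+ 2)).
Proof.
have s2 : psC (- s ^+ 2) * psC (- s^-1 ^+ 2) = 1.
  by rewrite -(rmorphM (@psC F)) mulrNN -exprMn divff // expr1n rmorph1.
rewrite /jtp_lhs /qprod !big_ord_recr /=.
have -> : psC (s ^+ 2 + s^-1 ^+ 2) = - (psC (- s ^+ 2) + psC (- s^-1 ^+ 2)).
  by rewrite -(rmorphD (@psC F)) -(rmorphN (@psC F)) opprD !opprK.
have -> : psq ^+ (2 * N).+2 =
    psC (- s ^+ 2) * psC (- s^-1 ^+ 2) * (psq ^+ N.+1 * psq ^+ N.+1).
  by rewrite s2 mul1r -exprD; congr (_ ^+ _); lia.
by ring.
Qed.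

(** A finite form of the triple product, by induction on N: the new factors multiply by [jtp_lhsS],
    and [jtp_coef_rec] is the matching recurrence for the coefficients. *)
Lemma finite_jtp N :
  jtp_lhs N = \sum_(n < N.+1) jtp_coef (N - n) n * psC (thchar n).
Proof.
elim: N => [|N IHN].
  rewrite big_ord1 jtp_coef_top mul1r /jtp_lhs /qprod !big_ord0 !mulr1.
  by rewrite /thchar !expr1 addrC.
rewrite jtp_lhsS {}IHN mulr_suml.
pose Q : pser F := psq ^+ N.+1; pose c n := psC (thchar n).
pose a n := jtp_coef (N - n) n; pose R : pser F := 1 + psq ^+ (2 * N).+2.
have lhsE (n : 'I_N.+1) : a n * c n * (R + Q * psC (s ^+ 2 + s^-1 ^+ 2)) =
    R * a n * c n + (Q * a n * c n.+1 + Q * a n * c n.-1).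
  (* The convention [0.-1 = 0] agrees with the folding at n = 0. *)
  have -> : c n.-1 = psC (if (n : nat) is n'.+1 then thchar n' else thchar 0).
    by case: (nat_of_ord n).
  have e : psC (s ^+ 2 + s^-1 ^+ 2) * c n = c n.+1
      + psC (if (n : nat) is n'.+1 then thchar n' else thchar 0).
    by rewrite -(rmorphM (@psC F)) thcharM rmorphD.
  transitivity (R * a n * c n + Q * a n * (psC (s ^+ 2 + s^-1 ^+ 2) * c n)).
    by ring.
  by rewrite e; ring.
have rhsE (n : 'I_N.+1) : jtp_coef (N.+1 - n) n * c n = R * a n * c n
    + (Q * jtp_prev (N - n) n * c n + Q * jtp_next (N - n) n * c n).
  have len : (n <= N)%N by rewrite -ltnS.
  by rewrite subSn // jtp_coef_rec subnKC // -/(a n) -/R -/Q; ring.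
rewrite (eq_bigr _ (fun n _ => lhsE n)) !big_split /=.
rewrite [RHS]big_ord_recr /= subnn jtp_coef_top.
rewrite [in RHS](eq_bigr _ (fun n _ => rhsE n)) !big_split /=.
rewrite -[RHS]addrA; congr (_ + _).
rewrite big_ord_recr [X in _ + X]big_ord_recl /=.
rewrite [in RHS]big_ord_recl [X in _ = _ + X + _]big_ord_recr /=.
have -> : Q * jtp_prev (N - 0) 0 * c 0%N = Q * a 0%N * c 0%N by [].
have -> : Q * jtp_next (N - N) N * c N = 0 by rewrite subnn mulr0 mul0r.
have -> : Q * a N * c N.+1 = psq ^+ trinum N.+1 * psC (thchar N.+1).
  by rewrite /a subnn jtp_coef_top -exprD trinumS addnC.
have -> : \sum_(i < N) Q * jtp_prev (N - lift ord0 i) (lift ord0 i) *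
    c (lift ord0 i) = \sum_(i < N) Q * a i * c i.+1.
  apply: eq_bigr => i _; rewrite !lift0 /a /=; congr (_ * jtp_coef _ _ * _).
  by move: (ltn_ord i); lia.
have -> : \sum_(i < N) Q * jtp_next (N - i) i * c i =
    \sum_(i < N) Q * a (lift ord0 i) * c (lift ord0 i).-1.
  apply: eq_bigr => i _; rewrite !lift0 /a /=.
  by rewrite -(subnSK (ltn_ord i)).
by rewrite addr0 /=; ring.
Qed.

Lemma jacobi_triple_product :
  psC (s^-1 + s) * (poch * (qpoch (- s ^+ 2 *: 'X) : pser F)
    * (qpoch (- s^-1 ^+ 2 *: 'X) : pser F))
  = psum (fun n => psq ^+ trinum n * psC (thchar n)).
Proof.
apply/funext => N.
transitivity ((poch * jtp_lhs N) N).
  have -> : poch * jtp_lhs N = psC (s^-1 + s) *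
      (poch * qprod (- s ^+ 2) N * qprod (- s^-1 ^+ 2) N).
    by rewrite /jtp_lhs; ring.
  apply: (@eqmM _ N) => //; apply: eqmM; last exact: qpoch_qprod.
  by apply: eqmM => //; apply: qpoch_qprod.
rewrite finite_jtp mulr_sumr /psum ps_sum; apply: eq_bigr => n _.
rewrite mulrA; apply: (@eqmM _ N) => //.
(* The precision N - n + T_n is at least N because T_n >= n. *)
apply: eqm_le (@jtp_coef_eqm (N - n) n).
by have := trinum_ge n; have := ltn_ord n; lia.
Qed.

End JacobiTripleProduct.

(** Summation by parts. With b the characters, it trades the powers in c for characters with the
    differences of g as coefficients. *)
Lemma sum_abel (F : fieldType) (g : nat -> pser F) (b c : nat -> F) N :
  c 0%N = b 0%N -> (forall n, c n.+1 = b n.+1 - b n) ->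
  \sum_(n < N.+1) g n * psC (c n) =
  \sum_(n < N.+1) (g n - g n.+1) * psC (b n) + g N.+1 * psC (b N).
Proof.
move=> c0 cS; elim: N => [|N IHN]; first by rewrite !big_ord1 c0; ring.
by rewrite big_ord_recr IHN [in RHS]big_ord_recr /= cS rmorphB; ring.
Qed.

Lemma psum_abel (F : fieldType) (g : nat -> pser F) (b c : nat -> F) :
  qsmall g -> c 0%N = b 0%N -> (forall n, c n.+1 = b n.+1 - b n) ->
  psum (fun n => g n * psC (c n)) = psum (fun n => (g n - g n.+1) * psC (b n)).
Proof.
move=> sg c0 cS; apply/funext => N; rewrite /psum.
transitivity ((\sum_(n < N.+1) g n * psC (c n)) N); first by rewrite ps_sum.
rewrite (sum_abel _ _ c0 cS) psD [g _ * _]mulrC ps_mulC_coef sg // mulr0 addr0.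
by rewrite ps_sum.
Qed.

(** * The double sum for G *)

Lemma ps_ge0_psum f : (forall n, ps_ge0 (f n)) -> ps_ge0 (psum f).
Proof. by move=> f0 N; rewrite /psum sumr_ge0 // => i _; apply: f0. Qed.

Lemma oddmoment_ge0 : ps_ge0 oddmoment.
Proof.
apply: ps_ge0_psum => j; apply: ps_ge0M; first exact/ps_ge0X/ps_ge0q.
by apply: ps_ge0C; apply: ler0n.
Qed.

Lemma evenmoment_ge0 : ps_ge0 evenmoment.
Proof.
apply: ps_ge0_psum => j; apply: ps_ge0M; first exact/ps_ge0X/ps_ge0q.
by apply: ps_ge0C; apply: ler0n.
Qed.

Definition qsquare (k : nat) : nat := k * k %/ 4.

Lemma qsquare_even j : qsquare (2 * j) = (j * j)%N.
Proof. by rewrite /qsquare; nia. Qed.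

Lemma qsquare_odd j : qsquare (2 * j).+1 = (j * j + j)%N.
Proof. by rewrite /qsquare; nia. Qed.

(* The coefficient of y ^ a + y ^ -a in (q; q)_oo ^ 6 * G. *)
Definition Gcoef (F : fieldType) (a : nat) : pser F :=
  psq ^+ qsquare a * (if odd a then evenmoment else oddmoment).

Lemma even_or_odd (a : nat) :
  (exists j, a = 2 * j)%N \/ (exists j, a = (2 * j).+1)%N.
Proof. by case: (boolP (odd a)) => oa; [right | left]; exists a./2; lia. Qed.

Lemma Gcoef_even (F : fieldType) j :
  Gcoef F (2 * j) = psq ^+ (j * j) * oddmoment.
Proof. by rewrite /Gcoef qsquare_even oddM. Qed.

Lemma Gcoef_odd (F : fieldType) j :
  Gcoef F (2 * j).+1 = psq ^+ (j * j + j) * evenmoment.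
Proof. by rewrite /Gcoef qsquare_odd /= oddM. Qed.

(** With M_0 and M_1 the odd and even moments, a = 2j leads to M_0 - q^j M_1 = (M_0 - M_1) + (1 -
    q^j) M_1, and a = 2j + 1 to M_1 - q^(j+1) M_0 = (M_1 - q M_0) + q (1 - q^j) M_0. Both parts are
    nonnegative after division by (q; q)^6. *)
Lemma Gcoef_decr a : ps_ge0 ((Gcoef rat a - Gcoef rat a.+1) * ipoch ^+ 6).
Proof.
have EO := ipoch_geo1 2 odd_sub_even_ge0.
have OE := ipoch_geo1 3 even_sub_odd_ge0.
case: (even_or_odd a) => [[j ->]|[j ->]].
  rewrite Gcoef_even Gcoef_odd exprD -mulrA -mulrBr -mulrA.
  apply: ps_ge0M; first exact/ps_ge0X/ps_ge0q.
  have -> : (oddmoment - psq ^+ j * evenmoment) * ipoch ^+ 6 =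
      (oddmoment - evenmoment) * ipoch ^+ (4 + 2)
      + evenmoment * ((1 - psq ^+ j) * ipoch ^+ 6) :> pser rat by ring.
  apply: ps_ge0D => //; apply: ps_ge0M; first exact: evenmoment_ge0.
  exact: ipochX_diff_ge0.
rewrite Gcoef_odd (_ : (2 * j).+2 = 2 * j.+1)%N; last by lia.
rewrite Gcoef_even (_ : (j.+1 * j.+1 = j * j + j + j.+1)%N); last by lia.
rewrite (exprD _ (j * j + j)) -mulrA -mulrBr -mulrA.
apply: ps_ge0M; first exact/ps_ge0X/ps_ge0q.
have -> : (evenmoment - psq ^+ j.+1 * oddmoment) * ipoch ^+ 6 =
    (evenmoment - psq * oddmoment) * ipoch ^+ (3 + 3)
    + psq * (oddmoment * ((1 - psq ^+ j) * ipoch ^+ 6)) :> pser rat.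
  by rewrite exprS; ring.
apply: ps_ge0D => //; apply: ps_ge0M; first exact: ps_ge0q.
apply: ps_ge0M; first exact: oddmoment_ge0.
exact: ipochX_diff_ge0.
Qed.

Lemma psmap_Gcoef (F F' : fieldType) (phi : {rmorphism F -> F'}) a :
  psmap phi (Gcoef F a) = Gcoef F' a.
Proof.
rewrite rmorphM rmorphXn /= psmap_q; congr (_ * _).
by case: odd; rewrite ?psmap_evenmoment ?psmap_oddmoment.
Qed.

Section SumLemmas.
Variable V : zmodType.

Lemma sum_square_sym (H : nat -> nat -> V) M :
  \sum_(m < M) \sum_(n < M) H m n =
  \sum_(m < M) (H m m + \sum_(n < m) (H m n + H n m)).
Proof.
elim: M => [|M IHM]; first by rewrite !big_ord0.
rewrite big_ord_recr /= [RHS]big_ord_recr /= -IHM.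
under eq_bigr do rewrite big_ord_recr /=.
rewrite !big_split /= big_ord_recr /= -!addrA; congr (_ + _).
by rewrite [RHS]addrA [RHS]addrC; congr (_ + _); apply: addrC.
Qed.

Lemma sum_triangle (H : nat -> nat -> V) K :
  \sum_(s < K) \sum_(b < s.+1) H (s - b)%N b
    = \sum_(a < K) \sum_(b < K - a) H a b.
Proof.
elim: K => [|K IHK]; first by rewrite !big_ord0.
rewrite big_ord_recr /= IHK [RHS]big_ord_recr /= subSnn big_ord1.
have -> : \sum_(a < K) \sum_(b < K.+1 - a) H a b =
    \sum_(a < K) \sum_(b < K - a) H a b + \sum_(a < K) H a (K - a)%N.
  rewrite -big_split; apply: eq_bigr => a _.
  by rewrite subSn ?big_ord_recr // ltnW.
rewrite -addrA; congr (_ + _).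
rewrite (reindex_inj rev_ord_inj) big_ord_recr /= subnn subn0; congr (_ + _).
by apply: eq_bigr => i _; congr H; have := ltn_ord i; lia.
Qed.

Lemma sum_odd (H : nat -> V) K :
  \sum_(b < 2 * K) (if odd b then H b else 0) = \sum_(j < K) H (2 * j).+1.
Proof.
elim: K => [|K IHK]; first by rewrite !big_ord0.
rewrite (_ : (2 * K.+1 = (2 * K).+2)%N); last by lia.
by rewrite !big_ord_recr /= IHK oddM /= addr0.
Qed.

Lemma sum_even (H : nat -> V) K :
  \sum_(b < 2 * K) (if odd b then 0 else H b) = \sum_(j < K) H (2 * j)%N.
Proof.
elim: K => [|K IHK]; first by rewrite !big_ord0.
rewrite (_ : (2 * K.+1 = (2 * K).+2)%N); last by lia.
by rewrite !big_ord_recr /= IHK oddM /= addr0.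
Qed.

End SumLemmas.

Section ThetaWronskian.
Variables (F : fieldType) (s : F).
Hypotheses (s0 : s != 0) (two0 : (2 : F) != 0).

Definition ychar (k : nat) : F :=
  if k is 0%N then 1 else s ^+ (2 * k) + s^-1 ^+ (2 * k).

Definition thdiff (n : nat) : F := s ^+ (2 * n).+1 - s^-1 ^+ (2 * n).+1.

Definition halfodd (n : nat) : F := (2 * n).+1%:R / 2.

(* Term (m, n) of theta * theta'' - theta' ^ 2. *)
Definition wronsk (m n : nat) : F :=
  thchar s m * (halfodd n ^+ 2 * thchar s n)
  - (halfodd m * thdiff m) * (halfodd n * thdiff n).

Lemma wronsk_diag m : wronsk m m = ((2 * m).+1 ^ 2)%:R * ychar 0.
Proof.
rewrite /wronsk /thchar /thdiff /halfodd natrX /ychar mulr1.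
have xx : s ^+ (2 * m).+1 * s^-1 ^+ (2 * m).+1 = 1.
  by rewrite -exprMn divff // expr1n.
move: (s ^+ _) (s^-1 ^+ _) xx => a b ab.
transitivity ((2 * m).+1%:R ^+ 2 * (a * b)); first by field.
by rewrite ab mulr1.
Qed.

(** With h_n = n + 1/2 and Y for [ychar], the products of the [thchar] and of the [thdiff] are
    Y_(m+n+1) + Y_(m-n) and Y_(m+n+1) - Y_(m-n). Symmetrizing thus completes the squares (h_m -
    h_n)^2 and (h_m + h_n)^2. *)
Lemma wronsk_sym m n : (n < m)%N -> wronsk m n + wronsk n m =
  ((m - n) ^ 2)%:R * ychar (m + n).+1 + ((m + n).+1 ^ 2)%:R * ychar (m - n).
Proof.
move=> ltnm; have [b def_m] : exists b, m = (n + b.+1)%N.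
  by exists (m - n).-1; lia.
rewrite def_m addKn /ychar /wronsk /thchar /thdiff /halfodd.
have eM (x : F) : x ^+ (2 * (n + b.+1)).+1 = x ^+ (2 * n).+1 * x ^+ (2 * b.+1).
  by rewrite -exprD; congr (_ ^+ _); lia.
have eS (x : F) : x ^+ (2 * (n + b.+1 + n).+1) =
    x ^+ (2 * n).+1 ^+ 2 * x ^+ (2 * b.+1).
  by rewrite -exprM -exprD; congr (_ ^+ _); lia.
rewrite !eM !eS.
have xx : s ^+ (2 * n).+1 * s^-1 ^+ (2 * n).+1 = 1.
  by rewrite -exprMn divff // expr1n.
move: (s ^+ (2 * n).+1) (s^-1 ^+ (2 * n).+1) xx => x x' xx.
move: (s ^+ (2 * b.+1)) (s^-1 ^+ (2 * b.+1)) => z z'.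
have -> : (2 * (n + b.+1)).+1%:R = 2 * n%:R + 2 * b.+1%:R + 1 :> F.
  by rewrite -natr1 natrM natrD mulrDr.
have -> : (2 * n).+1%:R = 2 * n%:R + 1 :> F by rewrite -natr1 natrM.
have -> : ((n + b.+1 + n).+1 ^ 2)%:R = (2 * n%:R + b.+1%:R + 1) ^+ 2 :> F.
  by rewrite natrX -natr1 !natrD; congr (_ ^+ _); ring.
rewrite natrX; move: (n%:R : F) (b.+1%:R : F) => N B.
transitivity (B ^+ 2 * (x ^+ 2 * z + x' ^+ 2 * z')
  + (2 * N + B + 1) ^+ 2 * (x * x') * (z + z')); first by field.
by rewrite xx mulr1.
Qed.

(** (m+n+1)^2 + (m-n)^2 = 4 (T_m + T_n) + 1, and exactly one of the two squares is odd, so the floor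
    drops the 1/4. *)
Lemma qsquare_trinum m n : (n <= m)%N ->
  (qsquare (m + n).+1 + qsquare (m - n) = trinum m + trinum n)%N.
Proof.
have T2 k : (2 * trinum k = k * k.+1)%N.
  by elim: k => // k IHk; rewrite trinumS; nia.
move=> lenm; case: (even_or_odd (m - n)) => -[j e].
  have -> : m = (n + 2 * j)%N by lia.
  rewrite (_ : (n + 2 * j + n).+1 = (2 * (n + j)).+1)%N; last by lia.
  rewrite addKn qsquare_odd qsquare_even.
  by have := T2 (n + 2 * j)%N; have := T2 n; nia.
have -> : m = (n + (2 * j).+1)%N by lia.
rewrite (_ : (n + (2 * j).+1 + n).+1 = (2 * (n + j).+1))%N; last by lia.
rewrite addKn qsquare_odd qsquare_even.
by have := T2 (n + (2 * j).+1)%N; have := T2 n; nia.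
Qed.

(* With a = m + n + 1 and b = m - n, or conversely: see [qsquare_trinum]. *)
Definition latterm (a b : nat) : pser F :=
  psq ^+ (qsquare a + qsquare b) * psC ((b ^ 2)%:R * ychar a).

(** The pairs whose larger index is m fill the line a + b = 2m + 1, so the square of side M becomes
    the odd lines of the triangle a + b < 2M. *)
Lemma wronsk_antidiagonal M :
  \sum_(m < M) \sum_(n < M) psq ^+ (trinum m + trinum n) * psC (wronsk m n) =
  \sum_(a < 2 * M) \sum_(b < 2 * M - a)
     (if odd (a + b) then latterm a b else 0).
Proof.
rewrite -(sum_triangle (fun a b => if odd (a + b) then latterm a b else 0)).
rewrite (sum_square_sym (fun m n =>
  psq ^+ (trinum m + trinum n) * psC (wronsk m n))).
pose H t := \sum_(b < t.+1) latterm (t - b) b.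
transitivity (\sum_(t < 2 * M) if odd t then H t else 0); last first.
  apply: eq_bigr => t _; case: ifP => ot; last first.
    by rewrite big1 // => b _; rewrite subnK ?ot // -ltnS.
  by apply: eq_bigr => b _; rewrite subnK ?ot // -ltnS.
rewrite sum_odd; apply: eq_bigr => m _; rewrite /H.
rewrite (_ : (2 * m).+2 = m.+1 + m.+1)%N; last by lia.
have termE n : (n <= m)%N ->
    latterm ((2 * m).+1 - (m.+1 - n.+1)) (m.+1 - n.+1)
    + latterm ((2 * m).+1 - (m.+1 + n)) (m.+1 + n) =
    psq ^+ (trinum m + trinum n) * psC (((m - n) ^ 2)%:R * ychar (m + n).+1
      + ((m + n).+1 ^ 2)%:R * ychar (m - n)).
  move=> lenm; rewrite /latterm subSS addSn.
  rewrite (_ : (2 * m).+1 - (m - n) = (m + n).+1)%N; last by lia.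
  rewrite (_ : (2 * m).+1 - (m + n).+1 = m - n)%N; last by lia.
  by rewrite [X in _ + psq ^+ X * _]addnC qsquare_trinum // -mulrDr -(rmorphD
    (@psC F)).
rewrite big_split_ord /= [X in _ = X + _](reindex_inj rev_ord_inj) /=.
rewrite -big_split /= [RHS]big_ord_recr /= addrC; congr (_ + _).
  (* At n = m the point b = 0 has weight 0 and b = 2m + 1 gives the diagonal term. *)
  by rewrite termE // subnn exp0n // mul0r add0r wronsk_diag mul2n -addnn.
apply: eq_bigr => n _; rewrite termE; last exact: ltnW.
by rewrite -wronsk_sym // [(trinum n + _)%N]addnC -mulrDr -(rmorphD (@psC F)).
Qed.

Lemma latterm_sum M N a : (N.+1 < M)%N -> (a < 2 * M)%N ->
  eqm N (\sum_(b < 2 * M - a) (if odd (a + b) then latterm a b else 0))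
        (Gcoef F a * psC (ychar a)).
Proof.
move=> ltNM ltaM.
(* The inner congruence is required only if [a^2/4] <= N. For the remaining a, close to 2M, the
   inner sum may be too short to approximate the moment. *)
have eqmX k (f g : pser F) : ((k <= N)%N -> eqm (N - k) f g) ->
    eqm N (psq ^+ k * f) (psq ^+ k * g).
  move=> e i lei; rewrite !ps_mulqX; case: leqP => // leki.
  by rewrite e ?leq_sub2r // (leq_trans leki).
have termE b : latterm a b =
    psq ^+ qsquare a * (psq ^+ qsquare b * psC (b ^ 2)%:R * psC (ychar a)).
  by rewrite /latterm exprD rmorphM !mulrA.
have -> : \sum_(b < 2 * M - a) (if odd (a + b) then latterm a b else 0) =
    psq ^+ qsquare a * ((\sum_(b < 2 * M - a) (if odd (a + b) then
      psq ^+ qsquare b * psC (b ^ 2)%:R else 0)) * psC (ychar a)).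
  rewrite mulr_suml mulr_sumr; apply: eq_bigr => b _; rewrite termE.
  by case: odd; rewrite ?mul0r ?mulr0.
rewrite /Gcoef -mulrA; apply: eqmX => leaN; apply: eqmM => //.
pose c b : pser F := psq ^+ qsquare b * psC (b ^ 2)%:R.
case: (even_or_odd a) ltaM leaN => [[i ->]|[i ->]] ltaM leaN.
  rewrite oddM /= -mulnBr.
  under eq_bigr do rewrite oddD oddM /=.
  rewrite (sum_odd c) qsquare_even in leaN *.
  apply/eqm_sym; have -> : \sum_(j < M - i) c (2 * j).+1 = \sum_(j < M - i)
      psq ^+ (j * j.+1) * psC ((2 * j + 1) ^ 2)%:R.
    by apply: eq_bigr => j _; rewrite /c qsquare_odd addn1 mulnS addnC.
  apply: psum_eqm; last by nia.
  by apply: (@qsmall_qX _ (fun j => j * j.+1)%N) => j; rewrite leq_pmulr.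
rewrite /= oddM /= (_ : 2 * M - (2 * i).+1 = (2 * (M - i.+1)).+1)%N;
  last by lia.
have cE : \sum_(b < (2 * (M - i.+1)).+1)
    (if odd ((2 * i).+1 + b) then c b else 0) =
    \sum_(j < M - i.+1) psq ^+ (j.+1 * j.+1) * psC ((2 * j + 2) ^ 2)%:R.
  rewrite (eq_bigr (fun b : 'I__ => if odd b then 0 else c b)); last first.
    by move=> b _; rewrite /= oddD oddM /=; case: odd.
  rewrite big_ord_recr /= sum_even oddM /=.
  transitivity (\sum_(j < (M - i.+1).+1) c (2 * j)%N).
    by rewrite [RHS]big_ord_recr.
  rewrite big_ord_recl /= {1}/c muln0 exp0n // rmorph0 mulr0 add0r.
  apply: eq_bigr => j _; rewrite -[bump 0 j]/(j.+1) /c qsquare_even.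
  by rewrite (_ : 2 * j + 2 = 2 * j.+1)%N //; lia.
rewrite cE qsquare_odd in leaN *; apply: eqm_sym.
apply: (@psum_eqm _ (fun j => psq ^+ (j.+1 * j.+1) * psC ((2 * j + 2) ^ 2)%:R)).
  by apply: (@qsmall_qX _ (fun j => j.+1 * j.+1)%N) => j; lia.
by nia.
Qed.

Definition theta_series (w : nat -> F) : pser F :=
  psum (fun n => psq ^+ trinum n * psC (w n)).

Lemma theta_seriesM_eqm (v w : nat -> F) N M : (N < M)%N ->
  eqm N (theta_series v * theta_series w)
    (\sum_(m < M) \sum_(n < M) psq ^+ (trinum m + trinum n) * psC (v m * w n)).
Proof.
move=> ltNM; have sm (u : nat -> F) : qsmall (fun n =>
  psq ^+ trinum n * psC (u n)).
  by apply: qsmall_qX => n; apply: trinum_ge.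
apply: (eqm_trans (eqmM (psum_eqm (sm v) ltNM) (psum_eqm (sm w) ltNM))).
rewrite mulr_suml => i _; congr ((_ : pser F) i); apply: eq_bigr => m _.
rewrite mulr_sumr; apply: eq_bigr => n _.
by rewrite exprD rmorphM mulrACA.
Qed.

Lemma theta_wronskian_eqm N M : (N.+1 < M)%N ->
  eqm N (theta_series (thchar s)
           * theta_series (fun n => halfodd n ^+ 2 * thchar s n)
         - theta_series (fun n => halfodd n * thdiff n) ^+ 2)
        (\sum_(a < 2 * M) Gcoef F a * psC (ychar a)).
Proof.
move=> ltNM; have ltNM' := ltnW ltNM.
have wE : eqm N (theta_series (thchar s)
           * theta_series (fun n => halfodd n ^+ 2 * thchar s n)
         - theta_series (fun n => halfodd n * thdiff n) ^+ 2)
   (\sum_(m < M) \sum_(n < M) psq ^+ (trinum m + trinum n) * psC (wronsk m n)).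
  move=> i lei; rewrite psB expr2 !(theta_seriesM_eqm _ _ ltNM' lei) -psB.
  rewrite -sumrB; congr ((_ : pser F) i); apply: eq_bigr => m _.
  by rewrite -sumrB; apply: eq_bigr => n _; rewrite -mulrBr -(rmorphB (@psC F)).
apply: (eqm_trans wE); rewrite wronsk_antidiagonal => i lei.
rewrite !ps_sum; apply: eq_bigr => a _.
by apply: (latterm_sum ltNM _ lei); apply: ltn_ord.
Qed.

End ThetaWronskian.

(** * The generating series *)

Lemma ydy_ratK c : ydy (ratK c) = 0.
Proof.
rewrite /ydy (@dsE (ratK c) c%:P 1) ?oner_eq0 ?rmorph1 ?mulr1 //.
by rewrite !derivC mulr0 subr0 rmorph0 mul0r mulr0.
Qed.

Lemma ydy_ratK_mul c f : ydy (ratK c * f) = ratK c * ydy f.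
Proof. by rewrite ydyM ydy_ratK mul0r add0r. Qed.

Lemma two_neq0_Qs : (2 : Qs) != 0. Proof. exact: nat_neq0_Qs. Qed.

Lemma halfodd_ratK n : halfodd Qs n = ratK ((2 * n).+1%:R / 2).
Proof. by rewrite /halfodd fmorph_div !rmorph_nat. Qed.

Lemma ydy_pow k : ydy (sqrty ^+ k) = ratK (k%:R / 2) * sqrty ^+ k.
Proof. by rewrite (ydy_spow k) fmorph_div !rmorph_nat. Qed.

Lemma ydy_powV k : ydy (sqrty^-1 ^+ k) = - (ratK (k%:R / 2) * sqrty^-1 ^+ k).
Proof.
have -> : sqrty^-1 ^+ k = sqrty ^ (- k%:Z) by rewrite exprVn exprnN.
by rewrite ydy_spow fmorph_div !rmorph_nat mulrNz !mulNr.
Qed.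

Lemma ydy_thchar n : ydy (thchar sqrty n) = halfodd Qs n * thdiff sqrty n.
Proof.
by rewrite ydyD ydy_pow ydy_powV halfodd_ratK /thdiff mulrBr.
Qed.

Lemma ydy_thdiff n :
  ydy (halfodd Qs n * thdiff sqrty n) = halfodd Qs n ^+ 2 * thchar sqrty n.
Proof.
rewrite halfodd_ratK ydy_ratK_mul ydyD ydyN ydy_pow ydy_powV opprK -mulrDr.
by rewrite mulrA expr2.
Qed.

Definition ps_ydy (f : pser Qs) : pser Qs := fun n => ydy (f n).

Lemma ydy_sum (I : Type) (r : seq I) (P : pred I) (f : I -> Qs) :
  ydy (\sum_(i <- r | P i) f i) = \sum_(i <- r | P i) ydy (f i).
Proof. exact: (big_morph ydy ydyD ydy0). Qed.

Lemma ps_ydyM f g : ps_ydy (f * g) = ps_ydy f * g + f * ps_ydy g.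
Proof.
apply/funext => n; rewrite psD !psM -big_split /ps_ydy psM ydy_sum.
by apply: eq_bigr => i _; rewrite ydyM.
Qed.

Lemma ps_monomialE (F : fieldType) k (c : F) n :
  (psq ^+ k * psC c) n = if n == k then c else 0.
Proof.
rewrite ps_mulqX psCE subn_eq0 eqn_leq.
by case: (k <= n)%N; rewrite ?andbT ?andbF.
Qed.

Lemma ps_ydy_theta (w : nat -> Qs) :
  ps_ydy (theta_series w) = theta_series (fun n => ydy (w n)).
Proof.
apply/funext => n; rewrite /ps_ydy /theta_series /psum ydy_sum.
apply: eq_bigr => i _.
have e1 := ps_monomialE (trinum i) (w i) n.
have e2 := ps_monomialE (trinum i) (ydy (w i)) n.
transitivity (ydy (if n == trinum i then w i else 0)).
  by congr ydy; apply: e1.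
by rewrite e2; case: eqP; rewrite ?ydy0.
Qed.

Definition theta : pser Qs := theta_series (thchar sqrty).

Lemma theta1E : qcoefs theta1 = theta.
Proof.
rewrite /theta /theta_series -jacobi_triple_product ?sqrty_neq0 //.
apply/funext => n; rewrite ps_mulC_coef /=; congr (_ * _).
by rewrite /y -exprVn !scaleNr.
Qed.

Lemma theta0_neq0 : theta 0%N != 0.
Proof.
rewrite /theta /theta_series /psum big_ord1 mul1r psCE /= /thchar muln0 !expr1.
have s0 := sqrty_neq0.
have -> : sqrty + sqrty^-1 = (sqrty ^+ 2 + 1) / sqrty.
  by rewrite mulrDl expr2 mulfK // mul1r.
have -> : sqrty ^+ 2 + 1 = ratfun ('X^2 + 1%:P).
  by rewrite rmorphD rmorphXn rmorph1.
apply: mulf_neq0; last by rewrite invr_eq0.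
by rewrite ratfun_eq0 -size_poly_eq0 size_XnaddC.
Qed.

Definition theta_wronskian : pser Qs :=
  theta * ps_ydy (ps_ydy theta) - ps_ydy theta ^+ 2.

Lemma invE k : ps_inv (ps_exp (poch : pser Qs) k) = ipoch ^+ k.
Proof.
rewrite ps_expE; apply: ps_inv_unique.
by rewrite -exprMn poch_ipoch expr1n.
Qed.

(** theta^2 (theta'/theta)' = theta theta'' - theta'^2. The inverse psi of theta is eliminated
    through theta psi = 1 and the derivative of this relation. *)
Lemma GE : qcoefs G = ipoch ^+ 6 * theta_wronskian.
Proof.
rewrite /G /=.
change (qpoch 'X) with (poch : pser Qs).
change (ps_mul (ps_mul (ps_inv (ps_exp (poch :
  pser Qs) 6)) (ps_exp (qcoefs theta1) 2))
  (ps_ydy (ps_mul (ps_ydy (qcoefs theta1)) (ps_inv (qcoefs theta1))))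
    = ipoch ^+ 6 * theta_wronskian).
rewrite theta1E invE ps_expE !ps_mulE.
set psi : pser Qs := ps_inv theta.
have tp : theta * psi = 1 by apply: ps_mulV theta0_neq0.
have dtp : ps_ydy theta * psi + theta * ps_ydy psi = 0.
  rewrite -ps_ydyM tp; apply/funext => n; rewrite /ps_ydy ps1.
  by case: eqP => _; rewrite ?ydy1 ?ydy0.
change (ipoch ^+ 6 * theta ^+ 2 * ps_ydy (ps_ydy theta * psi) =
  ipoch ^+ 6 * theta_wronskian).
rewrite ps_ydyM /theta_wronskian.
move: (ps_ydy psi) (ps_ydy theta) dtp tp => p1 t1 e1 e2.
move: (ps_ydy t1) => t2.
have {}e1 : theta * p1 = - (t1 * psi) by apply/eqP; rewrite -addr_eq0 addrC e1.
have key : theta ^+ 2 * (t2 * psi + t1 * p1) = theta * t2 - t1 ^+ 2.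
  transitivity (theta * psi * theta * t2 + theta * t1 * (theta * p1)).
    by ring.
  rewrite e1; transitivity (theta * psi * (theta * t2 - t1 ^+ 2)).
    by ring.
  by rewrite e2 mul1r.
by rewrite -mulrA key.
Qed.

(** * Unimodality of all coefficients of a series *)

Definition all_coef (C : Qs -> Prop) (f : pser Qs) := forall n, C (f n).

Lemma unimodal_class_sum (I : Type) (r : seq I) p (f : I -> Qs) :
  (forall i, unimodal_class p (f i)) -> unimodal_class p (\sum_(i <- r) f i).
Proof.
move=> uf; apply: big_ind => //; first exact: unimodal_class0.
exact: unimodal_classD.
Qed.

Lemma strict_class_sum (I : Type) (r : seq I) p (f : I -> Qs) :
  (forall i, strict_class p (f i)) -> strict_class p (\sum_(i <- r) f i).
Proof.
by move=> uf; apply: big_ind => //; [left | apply: strict_classD].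
Qed.

Lemma unimodal_seriesM f g : all_coef (unimodal_class false) f ->
  all_coef (unimodal_class false) g -> all_coef (unimodal_class false) (f * g).
Proof.
move=> uf ug n; rewrite psM; apply: unimodal_class_sum => i.
exact: (@unimodal_classM false false).
Qed.

Lemma strict_seriesM p p' f g : all_coef (strict_class p) f ->
  all_coef (strict_class p') g -> all_coef (strict_class (p (+) p')) (f * g).
Proof.
by move=> uf ug n; rewrite psM; apply: strict_class_sum => i;
  apply: strict_classM.
Qed.

Lemma unimodal_series_ge0 f : ps_ge0 f ->
  all_coef (unimodal_class false) (psmap ratK f).
Proof. by move=> f0 n; apply: unimodal_class_ratK. Qed.

Lemma strict_series_ge0 f : ps_ge0 f ->
  all_coef (strict_class false) (psmap ratK f).
Proof. by move=> f0 n; apply: strict_class_ratK. Qed.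

Lemma unimodal_seriesX f k : all_coef (unimodal_class false) f ->
  all_coef (unimodal_class false) (f ^+ k).
Proof.
move=> uf; elim: k => [|k IHk]; last by rewrite exprS; apply: unimodal_seriesM.
by rewrite expr0 -(rmorph1 (psmap ratK)); apply: unimodal_series_ge0 ps_ge01.
Qed.

Lemma strict_seriesX p f k : all_coef (strict_class p) f ->
  all_coef (strict_class (odd k && p)) (f ^+ k).
Proof.
move=> uf; elim: k => [|k IHk].
  by rewrite expr0 -(rmorph1 (psmap ratK)); apply: strict_series_ge0 ps_ge01.
rewrite exprS (_ : odd k.+1 && p = p (+) (odd k && p)); last first.
  by rewrite /=; case: p {uf IHk}; case: odd.
exact: strict_seriesM.
Qed.

Lemma slchar_step r :
  slchar r.+2 = slchar r + (sqrty ^+ r.+2 + sqrty^-1 ^+ r.+2).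
Proof.
rewrite {1}/slchar big_ord_recl big_ord_recr /= muln0 subr0 addrCA.
rewrite exprVn exprnN; congr (_ + (_ + sqrty ^ _)); last first.
  by rewrite /bump; lia.
by apply: eq_bigr => i _; congr (sqrty ^ _); rewrite /bump; lia.
Qed.

Lemma ychar_slchar n :
  ychar sqrty n.+1 = slchar (2 * n.+1) - slchar (2 * n).
Proof.
rewrite (_ : 2 * n.+1 = (2 * n).+2)%N; last by lia.
by rewrite slchar_step addrC addKr /ychar (_ : 2 * n.+1 = (2 * n).+2)%N //; lia.
Qed.

Lemma thchar_slchar n :
  thchar sqrty n.+1 = slchar (2 * n.+1).+1 - slchar (2 * n).+1.
Proof.
rewrite (_ : 2 * n.+1 = (2 * n).+2)%N; last by lia.
by rewrite slchar_step addrC addKr /thchar (_ : 2 * n.+1 = (2 * n).+2)%N //;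
  lia.
Qed.

Lemma G_unimodal : all_coef (unimodal_class false) (qcoefs G).
Proof.
rewrite GE => N.
pose K := (2 * N.+2).-1.
have tE : theta_wronskian = theta_series (thchar sqrty)
    * theta_series (fun n => halfodd Qs n ^+ 2 * thchar sqrty n)
    - theta_series (fun n => halfodd Qs n * thdiff sqrty n) ^+ 2.
  rewrite /theta_wronskian /theta ps_ydy_theta.
  rewrite (funext ydy_thchar : (fun n => ydy (thchar sqrty n)) = _).
  rewrite ps_ydy_theta.
  by rewrite (funext ydy_thdiff :
    (fun n => ydy (halfodd Qs n * thdiff sqrty n)) = _).
have ltN : (N.+1 < N.+2)%N by [].
have eqW : eqm N theta_wronskian
    (\sum_(a < K.+1) (Gcoef Qs a - Gcoef Qs a.+1) * psC (slchar (2 * a))).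
  rewrite tE; apply: (eqm_trans (theta_wronskian_eqm sqrty_neq0 two_neq0_Qs
    ltN)).
  rewrite (_ : 2 * N.+2 = K.+1)%N; last by rewrite /K; lia.
  have c0 : ychar sqrty 0 = slchar (2 * 0) by rewrite muln0 slchar0.
  have abel := sum_abel (b := fun a =>
    slchar (2 * a)) (Gcoef Qs) K c0 ychar_slchar.
  move=> i lei; apply: (etrans (congr1 (fun f : pser Qs => f i) abel)).
  rewrite psD -[RHS]addr0; congr (_ + _).
  (* The boundary term of the summation by parts carries q^((N+2)^2), beyond order N. *)
  rewrite -mulrA ps_mulqX ifF //; apply/negbTE; rewrite -ltnNge.
  rewrite (_ : K.+1 = 2 * N.+2)%N; last by rewrite /K; lia.
  by rewrite qsquare_even; nia.
rewrite (eqmM (eqm_refl (ipoch ^+ 6)) eqW (leqnn N)).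
rewrite mulr_sumr ps_sum; apply: unimodal_class_sum => a.
have -> : ipoch ^+ 6 * ((Gcoef Qs a - Gcoef Qs a.+1) * psC (slchar (2 * a))) =
    psC (slchar (2 * a)) * psmap ratK ((Gcoef rat a - Gcoef rat a.+1) * ipoch
      ^+ 6).
  rewrite rmorphM rmorphB rmorphXn /= psmap_ipoch !psmap_Gcoef.
  by rewrite [RHS]mulrC mulrCA mulrA.
rewrite ps_mulC_coef mulrC; apply: unimodal_classZ; first exact: Gcoef_decr.
by have := unimodal_class_slchar (2 * a); rewrite oddM.
Qed.

(** The positive p n form an initial segment, so no character below the top one is missing. The
    induction carries the fact that the top index is still K as long as p K > 0. *)
Lemma strictchar_sum (p : nat -> rat) K :
  0 < p 0%N -> (forall n, 0 <= p n) -> (forall n, 0 < p n.+1 -> 0 < p n) ->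
  strict_class true (\sum_(n < K.+1) ratK (p n) * slchar (2 * n).+1).
Proof.
move=> p0 p_ge0 pS.
suff [t [st _]] : exists t, strictchar (2 * t).+1
    (\sum_(n < K.+1) ratK (p n) * slchar (2 * n).+1) /\ (0 < p K -> t = K).
  by right; exists (2 * t).+1; rewrite /= ?oddM.
elim: K => [|K [t [st tK]]].
  exists 0%N; split=> //; rewrite big_ord1 muln0; exists (p 0%N) => //.
  by rewrite /staircase big_ord1 subrr; apply: charpos0.
rewrite big_ord_recr /=; have := p_ge0 K.+1; rewrite le_eqVlt.
case/predU1P => [<-|pK]; first by exists t; rewrite rmorph0 mul0r addr0 ltxx.
exists K.+1; split=> //.
move: st; rewrite (tK (pS _ pK)) => -[c c0 pc].
(* The longer staircase is allotted the smaller of the old multiplicity and the new coefficient. *)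
have [m0 mc mp] : [/\ 0 < Num.min c (p K.+1), Num.min c (p K.+1) <= c
    & Num.min c (p K.+1) <= p K.+1].
  by rewrite lt_min c0 pK !ge_min !lexx orbT.
move: (Num.min _ _) m0 mc mp => m m0 mc mp; exists m => //.
rewrite (_ : 2 * K.+1 = (2 * K).+2)%N; last by lia.
rewrite staircaseSS; set S := staircase _ in pc *.
move: (\sum_(n < _) _) pc => f pc.
have -> : f + ratK (p K.+1) * slchar (2 * K).+3 - ratK m * (slchar (2 * K).+3
  + S)
   = ratK (p K.+1 - m) * slchar (2 * K).+3 + ((f - ratK c * S)
     + ratK (c - m) * S).
  have idE (R : comNzRingType) (a b d u v w : R) :
    a + b * u - d * (u + v) = (b - d) * u + ((a - w * v) + (w - d) * v) by ring.
  by rewrite !rmorphB; apply: idE.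
apply: charpos_add; rewrite ?subr_ge0 //.
apply: charposD; first by apply: charpos_le pc; lia.
apply: charposZ; first by rewrite subr_ge0.
by apply: charpos_le (charpos_staircase _); lia.
Qed.

Lemma theta_eta_strict : all_coef (strict_class true) (theta * ipoch ^+ 3).
Proof.
move=> N; rewrite mulrC.
have sq : qsmall (fun n => psq ^+ trinum n : pser Qs).
  by move=> n k ltkn; rewrite psqXE ltn_eqF // (leq_trans ltkn (trinum_ge n)).
rewrite /theta /theta_series.
(* Each [thchar] is a difference of consecutive odd characters, so the character of index 2n + 1
   receives q^(T_n) - q^(T_(n+1)) = q^(T_n) (1 - q^(n+1)). *)
rewrite (psum_abel (b := fun n => slchar (2 * n).+1) sq);
  last exact: thchar_slchar.
  rewrite psum_mulr; last first.
    move=> n k ltkn; rewrite mulrC ps_mulC_coef psB sq // sq ?subrr ?mulr0 //.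
    exact: ltnW.
  pose f n : pser rat := psq ^+ trinum n * ((1 - psq ^+ n.+1) * ipoch ^+ 3).
  rewrite /psum (eq_bigr (fun n : 'I_N.+1 => ratK (f n N) * slchar (2 * n).+1)).
    (* At order N the coefficient is positive exactly when T_n <= N, which is an initial segment of
       n. *)
    have f_gt0 n : (trinum n <= N)%N -> 0 < f n N.
      by move=> len; rewrite /f ps_mulqX len; apply: ipochX_diff_gt0.
    have f_eq0 n : (N < trinum n)%N -> f n N = 0.
      by move=> ltn; rewrite /f ps_mulqX leqNgt ltn.
    apply: (@strictchar_sum (fun n => f n N)) => [|n|n].
    - exact: f_gt0.
    - by case: (leqP (trinum n) N) => [/f_gt0/ltW //|/f_eq0 ->].
    - case: (leqP (trinum n.+1) N) => [le1 _|/f_eq0 e]; last by rewrite e ltxx.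
      by apply: f_gt0; apply: leq_trans le1; rewrite trinumS leq_addr.
  move=> n _; rewrite mulrA mulrC ps_mulC_coef mulrC; congr (_ * _).
  rewrite -[ratK _]/(psmap ratK (f n) N) /f !rmorphM rmorphB !rmorphXn /=.
  rewrite rmorph1 psmap_ipoch psmap_q; congr ((_ : pser Qs) N).
  by rewrite trinumS exprD; ring.
by rewrite muln0 slchar1 /thchar !expr1.
Qed.

Lemma qcoefE A h : qexp A = - 1 -> qcoef A (h%:R - 1) = qcoefs A h.
Proof.
by move=> eA; rewrite /qcoef eA opprK subrK natr_nat natrK.
Qed.

Lemma eta24_ge0 : ps_ge0 (ipoch ^+ 24).
Proof. exact/ps_ge0X/ipoch_ge0. Qed.

Lemma genN_strict d h : strict_class false (qcoef (genN d) (h%:R - 1)).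
Proof.
rewrite qcoefE; last first.
  (* The quotient theta_1 / eta^3 has q-exponent 0, so only the -1 from eta^-24 remains. *)
  rewrite /= (_ : 1 / 8%:R - (1 / 24%:R) *+ 3 = 0 :> rat) // mul0rn addr0.
  by [].
change (strict_class false (ps_mul (ps_inv (ps_exp (poch : pser Qs) 24))
  (ps_exp (ps_mul (qcoefs theta1) (ps_inv (ps_exp (poch : pser Qs) 3)))
     (2 * d - 2)) h)).
rewrite !invE theta1E ps_mulE ps_expE ps_mulE.
rewrite -(psmap_ipoch ratK) -rmorphXn.
apply: (@strict_seriesM false false); first exact: strict_series_ge0 eta24_ge0.
have := strict_seriesX (2 * d - 2) theta_eta_strict.
by rewrite (_ : odd (2 * d - 2) = false) ?psmap_ipoch //; lia.
Qed.

Lemma genN1_unimodal d h : unimodal_class false (qcoef (genN1 d) (h%:R - 1)).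
Proof.
(* The q-exponent of [G] evaluates to -6/24 + 2/8 = 0. *)
rewrite qcoefE; last by rewrite /= mul0rn.
change (unimodal_class false (ps_mul (ps_inv (ps_exp (poch : pser Qs) 24))
  (ps_exp (qcoefs G) (d - 1)) h)).
rewrite invE ps_expE ps_mulE -(psmap_ipoch ratK) -rmorphXn.
apply: unimodal_seriesM; first exact: unimodal_series_ge0 eta24_ge0.
exact: unimodal_seriesX G_unimodal.
Qed.

Lemma genN3_unimodal d h : unimodal_class false (qcoef (genN3 d) (h%:R - 1)).
Proof.
rewrite qcoefE; last by rewrite /= mul0rn.
apply: unimodal_classZ; first by rewrite mulr_ge0 ?divr_ge0 ?ler0n.
change (unimodal_class false (ps_mul (ps_inv (ps_exp (poch : pser Qs) 24))
  (qcoefs (qs_qdq (qs_exp G (d - 1)))) h)).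
rewrite invE ps_mulE -(psmap_ipoch ratK) -rmorphXn.
apply: unimodal_seriesM => [|n]; first exact: unimodal_series_ge0 eta24_ge0.
rewrite /= ps_expE; apply: unimodal_classZ.
  (* As powers of [G] have q-exponent 0, q d/dq multiplies the n-th coefficient by n >= 0. *)
  by rewrite mul0rn add0r ler0n.
exact: unimodal_seriesX G_unimodal _.
Qed.

Theorem theorem5p5 (d h : nat) (hd : (2 <= d)%N) :
  [/\ finitely_supported (GWN d h), symmetric_seq (GWN d h)
    & strictly_unimodal (GWN d h)]
  /\ [/\ finitely_supported (GWN1 d h), symmetric_seq (GWN1 d h)
       & unimodal (GWN1 d h)]
  /\ [/\ finitely_supported (GWN3 d h), symmetric_seq (GWN3 d h)
       & unimodal (GWN3 d h)].
Proof.
split; first exact: strict_class_seq (genN_strict d h).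
split; first exact: unimodal_class_seq (genN1_unimodal d h).
exact: unimodal_class_seq (genN3_unimodal d h).
Qed.
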